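(* Let $K,M,M_1>0$ be rational, $n\ge1$, and let $a\in(0,\frac{K}{M(1+nM_1)}]$ be rational. Let $Q\equiv(q_0,\dots,q_k)\in\mathcal{P}_{1,\mathbb{Q}}$ be a partition of $[0,a]$, let $(u,u')\in\mathcal{V}^1$, let $E^2$ be the second-order Euler operator, and let $\bot$ be the bottom element of $\mathcal{W}_{\mathcal{D}}$. Then $E^2_{(u,u')}(Q)=\psi^*$, where $$\psi=\operatorname{fix}F_{(u,u')}(Q)=\bigsqcup_{m\in\mathbb{N}}\left(F_{(u,u')}(Q)\right)^m(\bot)=\left(F_{(u,u')}(Q)\right)^{k+1}(\bot).$$
   Context: **Partitions.** A partition of $[0,a]$ is $Q=(q_0,\dots,q_k)$ with $k\ge1$, $0=q_0<\dots<q_k=a$; $|Q|=\max_i(q_i-q_{i-1})$; $\Delta_j=q_{j+1}-q_j$. $\mathcal{P}_{\mathbb{Q}}$ is the set of partitions with rational points and $\mathcal{P}_{1,\mathbb{Q}}$ the set of those with in addition $|Q|\le1$. **Interval notation.** For a box $R\subseteq\mathbb{R}^m$, $\mathbf{I}R$ is the set of non-empty compact boxes (products of closed intervals) contained in $R$, ordered by reverse inclusion ($\alpha\sqsubseteq\beta\iff\beta\subseteq\alpha$), with Scott topology. $A\Rightarrow B$ denotes the domain of Scott-continuous maps, ordered pointwise. $\alpha\oplus r$ is the Minkowski sum $\alpha+[-r,r]^n$. $T_{K,n}(X)=X\cap[-K,K]^n$. Arithmetic on boxes, interval matrices and interval vectors is interval arithmetic, and integrals of interval functions are taken by integrating lower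 and upper bounds. **$\mathcal{V}^1$.** For $h:[-K,K]^n\to\mathbb{R}$, $O$ relatively open and $b\subseteq\mathbb{R}^n$ a compact box (or $b=\mathbb{R}^n$), write $h\in\delta(O,b)$ if for all $x,y\in O$, $h(x)-h(y)\in\{\langle c,x-y\rangle: c\in b\}$. The $\overline{L}$-derivative is $\overline{L}(h)(x)=\bigcap\{b: x\in O,\ h\in\delta(O,b)\}$. For $h=(h_1,\dots,h_n)$, $\overline{L}(h)(x)$ is the $n\times n$ interval matrix with rows $\overline{L}(h_i)(x)$. The canonical interval extension $\boldsymbol{I}g$ of a (point- or set-valued) map $g$ sends a box $\alpha$ to the smallest box containing $\bigcup_{x\in\alpha}g(x)$. $\mathcal{V}^1$ is the set of pairs $(u,u')$ with $u\in\mathbf{I}[-K,K]^n\Rightarrow\mathbf{I}[-M,M]^n$, $u'\in\mathbf{I}[-K,K]^n\Rightarrow\mathbf{I}[-M_1,M_1]^{n^2}$ which are consistent: there is $h:[-K,K]^n\to[-M,M]^n$ with $u\sqsubseteq\boldsymbol{I}h$ and $u'\sqsubseteq\boldsymbol{I}\overline{L}(h)$. $(u'\cdot u)(\beta)$ is the product of the interval $n\times n$ matrix $u'(\beta)$ with the interval vector $u(\beta)$. **Operator $E^2$.** For $Q\in\mathcal{P}_{1,\mathbb{Q}}$, $y=E^2_{(u,u')}(Q):[0,a]\to\mathbf{I}[-K,K]^n$ is defined by $y(0)=(0,\dots,0)$ and, for $q_i<x\le q_{i+1}$, $$y(x)=y(q_i)+\int_{q_i}^x u(y(q_i))+(t-q_i)\,(u'\cdot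 u)\big(y(q_i)\oplus M\Delta_i\big)\,dt .$$ **$\mathcal{D}_{\mathbb{Q}}$ and $\mathcal{W}_{\mathcal{D}}$.** $[0,a]_{(\mathbb{Q}]}$ is $[0,a]$ with the topology with base $\{(p,q]\cap[0,a]: p,q\in\mathbb{Q}\}$. $\mathcal{D}_{\mathbb{Q}}$ is the dcpo of continuous maps $[0,a]_{(\mathbb{Q}]}\to\mathbf{I}[-K,K]^n$, ordered pointwise. $\mathcal{B}_{\mathcal{D}}$ is the set of step functions $\bigsqcup_{i\in I}b_i\chi_{O_i}$ in $\mathcal{D}_{\mathbb{Q}}$, $I$ finite, $O_i=(p_i,r_i]\cap[0,a]$ with $p_i,r_i\in\mathbb{Q}$, $b_i$ a box with rational coordinates; $b\chi_O$ equals $b$ on $O$ and the bottom $[-K,K]^n$ elsewhere. On $\mathcal{B}_{\mathcal{D}}$: $\bigsqcup_{i\in I}b_i\chi_{O_i}\vartriangleleft_{\mathcal{D}}\theta'$ iff for all $i\in I$ and $x\in O_i$, $b_i\ll\theta'(x)$ ($\ll$ the way-below relation of $\mathbf{I}[-K,K]^n$). For arbitrary $f,g:[0,a]\to\mathbf{I}[-K,K]^n$: $f\vartriangleleft_{\mathcal{D}}g$ iff $f\sqsubseteq\theta_1\vartriangleleft_{\mathcal{D}}\theta_2\sqsubseteq g$ for some $\theta_1,\theta_2\in\mathcal{B}_{\mathcal{D}}$. $\mathcal{W}_{\mathcal{D}}$ is the set of rounded ideals of $(\mathcal{B}_{\mathcal{D}},\vartriangleleft_{\mathcal{D}})$ ordered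 by inclusion (a rounded ideal is a non-empty lower set $\phi$ such that each finite $A\subseteq\phi$ has $z\in\phi$ with $x\vartriangleleft_{\mathcal{D}}z$ for all $x\in A$). For $f\in\mathcal{D}_{\mathbb{Q}}$, $f_*=\{b\in\mathcal{B}_{\mathcal{D}}: b\vartriangleleft_{\mathcal{D}}f\}$; for $\phi\in\mathcal{W}_{\mathcal{D}}$, $\phi^*=\bigsqcup_{b\in\phi}b$. **Operators $\Phi$ and $F$.** For $Q\in\mathcal{P}_{\mathbb{Q}}$, $(u,u')\in\mathcal{V}^1$, $\phi\in\mathcal{D}_{\mathbb{Q}}$, $\Phi_{(u,u')}(Q)(\phi)=y_\phi$, where $y_\phi(0)=(0,\dots,0)$ and, for $q_j<x\le q_{j+1}$, $$y_\phi(x)=T_{K,n}\Big[\phi(q_j)+\int_{q_j}^x u(\phi(q_j))+(t-q_j)\,(u'\cdot u)\big(T_{K,n}(\phi(q_j)\oplus M\Delta_j)\big)\,dt\Big].$$ For $\phi\in\mathcal{W}_{\mathcal{D}}$, $F_{(u,u')}(Q)(\phi)=\big(\Phi_{(u,u')}(Q)(\phi^* )\big)_*\in\mathcal{W}_{\mathcal{D}}$ (this is understood at those $\phi$ for which every clipped set in the formula for $\Phi_{(u,u')}(Q)(\phi^* )$ is non-empty). $\operatorname{fix}G$ denotes $\bigsqcup_{m\in\mathbb{N}}G^m(\bot)$. *)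

(* Defs.v *)
From HB Require Import structures.
From mathcomp Require Import all_boot all_order all_algebra.
From mathcomp Require Import all_classical all_reals all_analysis.

Set Implicit Arguments.
Unset Strict Implicit.
Unset Printing Implicit Defensive.

Import Order.TTheory GRing.Theory Num.Theory.
Import numFieldNormedType.Exports.

Local Open Scope classical_set_scope.
Local Open Scope ring_scope.

Section OrderTheory.
Context {d : Order.disp_t} {T : porderType d}.
Implicit Types (S U : set T) (x y : T).

Definition directed S :=
  S !=set0 /\
  forall x y, S x -> S y -> exists z, [/\ S z, (x <= z)%O & (y <= z)%O].

Definition scott_open U :=
  (forall x y, U x -> (x <= y)%O -> U y) /\
  (forall S s, directed S -> supremums S s -> U s -> S `&` U !=set0).

Definition way_below x y :=
  forall S s, directed S -> supremums S s -> (y <= s)%O ->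
    exists2 z, S z & (x <= z)%O.

Lemma scott_openT : scott_open setT.
Proof. by split=> // S s [[x Sx] _] _ _; exists x. Qed.

Lemma scott_openI : setI_closed scott_open.
Proof.
move=> U V [Uup Uin] [Vup Vin]; split=> [x y [Ux Vx] xy|S s dS sS [Us Vs]].
  by split; [exact: Uup xy|exact: Vup xy].
have [x [Sx Ux]] := Uin S s dS sS Us; have [y [Sy Vy]] := Vin S s dS sS Vs.
have [z [Sz xz yz]] := dS.2 x y Sx Sy.
by exists z; split=> //; split; [exact: Uup xz|exact: Vup yz].
Qed.

Lemma scott_open_bigU (I : Type) (f : I -> set T) :
  (forall i, scott_open (f i)) -> scott_open (\bigcup_i f i).
Proof.
move=> fo; split=> [x y [i _ fix_] xy|S s dS sS [i _ fis]].
  by exists i => //; exact: (fo i).1 xy.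
have [x [Sx fx]] := (fo i).2 S s dS sS fis.
by exists x; split=> //; exists i.
Qed.

End OrderTheory.

(* A box is given by the matrices of its lower and of its upper endpoints; it
   is empty when some lower endpoint exceeds the upper one. Vectors are
   columns, and interval m x n matrices are the elements of [box R m n]. *)
Definition box (R : realType) (m n : nat) : Type :=
  ('M[R]_(m, n) * 'M[R]_(m, n))%type.
HB.instance Definition _ (R : realType) (m n : nat) :=
  Choice.copy (box R m n) ('M[R]_(m, n) * 'M[R]_(m, n))%type.

Section Boxes.
Context {R : realType}.

Definition bset m n (b : box R m n) : set 'M[R]_(m, n) :=
  [set x | forall i j, b.1 i j <= x i j <= b.2 i j].

Definition cube m n (r : R) : set 'M[R]_(m, n) :=
  [set x | forall i j, - r <= x i j <= r].

(* b is non-empty and contained in [-r, r]^(m x n) *)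
Definition in_cube m n (r : R) (b : box R m n) : bool :=
  [forall i, forall j,
    [&& - r <= b.1 i j, b.1 i j <= b.2 i j & b.2 i j <= r]].

Definition bcube m n (r : R) : box R m n := (const_mx (- r), const_mx r).

Definition badd m n (b c : box R m n) : box R m n :=
  (b.1 + c.1, b.2 + c.2).

(* Minkowski sum of b and the cube [-r, r]^(m x n) *)
Definition bfatten m n (b : box R m n) (r : R) : box R m n :=
  badd b (bcube m n r).

(* intersection of b with the cube [-r, r]^(m x n), possibly empty *)
Definition bclip m n (r : R) (b : box R m n) : box R m n :=
  (\matrix_(i, j) Num.max (b.1 i j) (- r), \matrix_(i, j) Num.min (b.2 i j) r).

Definition bscale m n (c : R) (b : box R m n) : box R m n :=
  (\matrix_(i, j) Num.min (c * b.1 i j) (c * b.2 i j),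
   \matrix_(i, j) Num.max (c * b.1 i j) (c * b.2 i j)).

(* [a, b] * [c, d] is [imul_lo a b c d, imul_hi a b c d] *)
Definition imul_lo (a b c d : R) : R :=
  Num.min (Num.min (a * c) (a * d)) (Num.min (b * c) (b * d)).
Definition imul_hi (a b c d : R) : R :=
  Num.max (Num.max (a * c) (a * d)) (Num.max (b * c) (b * d)).

Definition bmulmx m p n (A : box R m p) (B : box R p n) : box R m n :=
  (\matrix_(i, k) \sum_j imul_lo (A.1 i j) (A.2 i j) (B.1 j k) (B.2 j k),
   \matrix_(i, k) \sum_j imul_hi (A.1 i j) (A.2 i j) (B.1 j k) (B.2 j k)).

Definition bintegral m n (p q : R) (f : R -> box R m n) : box R m n :=
  (\matrix_(i, j) (\int[lebesgue_measure]_(t in `[p, q]) (f t).1 i j),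
   \matrix_(i, j) (\int[lebesgue_measure]_(t in `[p, q]) (f t).2 i j)).

Lemma in_cubeP m n (r : R) (b : box R m n) :
  reflect (bset b !=set0 /\ bset b `<=` cube r) (in_cube r b).
Proof.
apply: (iffP forallP) => [H|[[x bx] bs] i].
  have {}H i j := and3P (forallP (H i) j).
  split; first by exists b.1 => i j; case: (H i j) => _ -> _; rewrite lexx.
  move=> x bx i j; have [h1 _ h2] := H i j; have /andP[h3 h4] := bx i j.
  by rewrite (le_trans h1 h3) (le_trans h4 h2).
have le12 i' j' : b.1 i' j' <= b.2 i' j'.
  by have /andP[+] := bx i' j'; exact: le_trans.
apply/forallP => j.
have /bs/(_ i j)/andP[-> _] : bset b b.1 by move=> k l; rewrite lexx le12.
have /bs/(_ i j)/andP[_ ->] : bset b b.2 by move=> k l; rewrite lexx le12.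
by rewrite le12.
Qed.

End Boxes.

Arguments cube {R} m n r.

(* The domain of the non-empty compact boxes contained in [-r, r]^(m x n). *)
Record cbox (R : realType) (r : {posnum rat}) (m n : nat) := CBox {
  cval :> box R m n;
  cvalP : in_cube (ratr r%:num) cval }.

HB.instance Definition _ (R : realType) r m n := [isSub for @cval R r m n].
HB.instance Definition _ (R : realType) r m n :=
  [Choice of cbox R r m n by <:].

Fact cbox_display : Order.disp_t. Proof. exact: Order.Disp tt tt. Qed.

Section CboxOrder.
Context {R : realType} (r : {posnum rat}) (m n : nat).

Definition cbox_le (b c : cbox R r m n) : bool := `[< bset c `<=` bset b >].

Lemma cbox_le_refl : reflexive cbox_le.
Proof. by move=> b; apply/asboolP. Qed.

Lemma cbox_le_trans : transitive cbox_le.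
Proof.
move=> b a c /asboolP ab /asboolP bc; apply/asboolP.
exact: subset_trans bc ab.
Qed.

Lemma cbox_lohi (b : cbox R r m n) i j : (cval b).1 i j <= (cval b).2 i j.
Proof. by have /forallP/(_ i)/forallP/(_ j)/and3P[] := cvalP b. Qed.

Lemma cbox_subP (b c : cbox R r m n) : bset c `<=` bset b -> forall i j,
  ((cval b).1 i j <= (cval c).1 i j) && ((cval c).2 i j <= (cval b).2 i j).
Proof.
move=> cb i j.
have /cb/(_ i j)/andP[-> _] : bset c (cval c).1.
  by move=> k l; rewrite lexx cbox_lohi.
have /cb/(_ i j)/andP[_ ->] // : bset c (cval c).2.
by move=> k l; rewrite lexx cbox_lohi.
Qed.

Lemma cbox_le_anti : antisymmetric cbox_le.
Proof.
move=> b c /andP[/asboolP/cbox_subP cb /asboolP/cbox_subP bc]; apply: val_inj.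
rewrite /= [LHS]surjective_pairing [RHS]surjective_pairing.
by congr pair; apply/matrixP => i j; apply/le_anti;
  have /andP[? ?] := cb i j; have /andP[? ?] := bc i j; apply/andP.
Qed.

HB.instance Definition _ := Order.Le_isPOrder.Build cbox_display (cbox R r m n)
  cbox_le_refl cbox_le_anti cbox_le_trans.

HB.instance Definition _ := isOpenTopological.Build (cbox R r m n)
  scott_openT scott_openI (@scott_open_bigU _ (cbox R r m n)).

Lemma bcube_in_cube : in_cube (ratr r%:num) (@bcube R m n (ratr r%:num)).
Proof.
have r0 : 0 <= ratr r%:num :> R by rewrite ler0q.
by do 2!apply/forallP => ?; rewrite !mxE !lexx /= (le_trans _ r0) // oppr_le0.
Qed.

Definition cbot : cbox R r m n := CBox bcube_in_cube.

(* b as an element of the domain; bottom if b is not one *)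
Definition tocbox (b : box R m n) : cbox R r m n := insubd cbot b.

Definition rat_box (b : cbox R r m n) : Prop :=
  exists l h : 'M[rat]_(m, n), cval b = (map_mx ratr l, map_mx ratr h).

End CboxOrder.

Arguments cbot {R} r m n.
Arguments tocbox {R} r {m n} b.

(* [0, a], with the topology whose base is the sets (p, q] with p, q rational *)
Record time (R : realType) (a : {posnum rat}) := Time {
  tval :> R;
  tvalP : 0 <= tval <= ratr a%:num }.

HB.instance Definition _ (R : realType) a := [isSub for @tval R a].
HB.instance Definition _ (R : realType) a := [Choice of time R a by <:].

Section Time.
Context {R : realType} (a : {posnum rat}).

Definition ocint (pq : rat * rat) : set (time R a) :=
  [set x | ratr pq.1 < tval x <= ratr pq.2].

Lemma ocint_cover : \bigcup_(pq in setT) ocint pq = setT.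
Proof.
apply/seteqP; split=> // x _; exists (-1, a%:num) => //; rewrite /ocint/=.
by have /andP[x0 ->] := tvalP x; rewrite andbT (lt_le_trans _ x0) // ltrq0.
Qed.

Lemma ocint_join (i j : rat * rat) t : setT i -> setT j ->
  ocint i t -> ocint j t ->
  exists k, [/\ setT k, ocint k t & ocint k `<=` ocint i `&` ocint j].
Proof.
case: i j => [p q] [p' q'] _ _; rewrite /ocint/= => /andP[pt tq] /andP[pt' tq'].
exists (Num.max p p', Num.min q q'); split=> //=.
  by rewrite /Num.max /Num.min; apply/andP; split; case: ifP.
have lr (y z : rat) : y <= z -> ratr y <= ratr z :> R by rewrite ler_rat.
move=> x /andP[px xq]; split; apply/andP; split.
- by apply: (le_lt_trans _ px); rewrite lr // le_max lexx.
- by apply: (le_trans xq); rewrite lr // ge_min lexx.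
- by apply: (le_lt_trans _ px); rewrite lr // le_max lexx orbT.
- by apply: (le_trans xq); rewrite lr // ge_min lexx orbT.
Qed.

HB.instance Definition _ := isBaseTopological.Build (time R a)
  ocint_cover ocint_join.

Lemma time0P : 0 <= (0 : R) <= ratr a%:num.
Proof. by rewrite lexx ler0q /=. Qed.

Definition time0 : time R a := Time time0P.

(* the rational number q as a point of [0, a]; 0 if q is outside [0, a] *)
Definition ratpt (q : rat) : time R a := insubd time0 (ratr q : R).

End Time.

Arguments ratpt R a q : clear implicits.

Section Partitions.
Implicit Type Q : seq rat.

Definition step_size Q i : rat := Q`_i.+1 - Q`_i.

Definition mesh Q : rat := \big[Num.max/0]_(i < (size Q).-1) step_size Q i.

(* Q = (q_0, ..., q_k) is a sequence of size k + 1 with q_i = Q`_i *)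
Definition partition (a : rat) Q : Prop :=
  [/\ (1 < size Q)%N, Q`_0 = 0, last 0 Q = a & sorted <%R Q].

Definition partition1 a Q : Prop := partition a Q /\ mesh Q <= 1.

(* For 0 < x <= a, the index i such that q_i < x <= q_(i+1) *)
Definition piece (R : realType) Q (x : R) : nat :=
  (find (fun q => x <= ratr q) Q).-1.

End Partitions.

Section LDerivative.
Context {R : realType} (K : R) (n : nat).
Implicit Types (h : 'cV[R]_n -> R) (O : set 'cV[R]_n) (b : set 'rV[R]_n).

Definition rel_open O : Prop := exists2 U, open U & O = U `&` cube n 1 K.

(* Gradients are rows, so <c, x - y> is the only entry of c *m (x - y). *)
Definition in_delta h O b : Prop :=
  forall x y, O x -> O y -> exists2 c, b c & h x - h y = (c *m (x - y)) 0 0.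

Definition box_or_full b : Prop :=
  b = setT \/ exists2 B : box R 1 n, bset B !=set0 & b = bset B.

Definition Lder h (x : 'cV[R]_n) : set 'rV[R]_n :=
  [set c | forall O b, rel_open O -> box_or_full b -> O x -> in_delta h O b ->
    b c].

Definition LderV (h : 'cV[R]_n -> 'cV[R]_n) (x : 'cV[R]_n) : set 'M[R]_n :=
  [set A | forall i, Lder (fun z => h z i 0) x (row i A)].

(* Smallest box containing the image of b, as the intersection of the compact
   boxes containing it; this is the whole space when the image is unbounded,
   and is then contained in no compact box, as required in [V1]. *)
Definition Iext p q (g : 'cV[R]_n -> set 'M[R]_(p, q)) (b : box R n 1) :
    set 'M[R]_(p, q) :=
  \bigcap_(B in [set B : box R p q | \bigcup_(x in bset b) g x `<=` bset B])
    bset B.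

End LDerivative.

Section Operators.
Context {R : realType} {n : nat} {K M M1 a : {posnum rat}}.
Let IK := cbox R K n 1.
Let T := time R a.
Context (u : IK -> cbox R M n 1) (u' : IK -> cbox R M1 n n).
Implicit Types (Q : seq rat) (f g th : T -> IK) (phi psi : set (T -> IK)).

Definition V1 : Prop :=
  [/\ continuous u, continuous u' &
    exists h : 'cV[R]_n -> 'cV[R]_n,
      [/\ forall x, cube n 1 (ratr K%:num) x -> cube n 1 (ratr M%:num) (h x),
        forall b, Iext (fun x => [set h x]) (cval b) `<=` bset (u b) &
        forall b, Iext (LderV (ratr K%:num) h) (cval b) `<=` bset (u' b)]].

(* al + \int_q^x (u(al) + (t - q) (u' . u)(be)) dt *)
Definition taylor_step (al be : IK) (q x : R) : box R n 1 :=
  badd al (bintegral q x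
    (fun t => badd (u al) (bscale (t - q) (bmulmx (u' be) (u be))))).

Definition zerobox : IK := tocbox K (0, 0).

Definition fat Q i (al : IK) : box R n 1 :=
  bfatten al (ratr (M%:num * step_size Q i)).

(* the value of y on (q_i, q_(i+1)] when y(q_i) = al *)
Definition E2_step Q i (al : IK) (x : R) : box R n 1 :=
  taylor_step al (tocbox K (fat Q i al)) (ratr Q`_i) x.

(* E2_node Q i is y(q_i) *)
Fixpoint E2_node Q (i : nat) : IK :=
  if i is i'.+1
  then tocbox K (E2_step Q i' (E2_node Q i') (ratr Q`_i))
  else zerobox.

Definition E2 Q : T -> IK := fun x =>
  if tval x == 0 then zerobox else
  let i := piece Q (tval x) in
  tocbox K (E2_step Q i (E2_node Q i) (tval x)).

(* every box to which [tocbox] is applied in [E2] is in the domain *)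
Definition E2_defined Q : Prop :=
  forall i, (i.+1 < size Q)%N ->
    in_cube (ratr K%:num) (fat Q i (E2_node Q i)) /\
    forall x : R, ratr Q`_i < x <= ratr Q`_i.+1 ->
      in_cube (ratr K%:num) (E2_step Q i (E2_node Q i) x).

Definition clip_fat Q i (al : IK) : box R n 1 :=
  bclip (ratr K%:num) (fat Q i al).

Definition Phi_step Q i (al : IK) (x : R) : box R n 1 :=
  bclip (ratr K%:num)
    (taylor_step al (tocbox K (clip_fat Q i al)) (ratr Q`_i) x).

Definition Phi Q f : T -> IK := fun x =>
  if tval x == 0 then zerobox else
  let i := piece Q (tval x) in
  tocbox K (Phi_step Q i (f (ratpt R a Q`_i)) (tval x)).

(* every clipped set in [Phi Q f] is non-empty *)
Definition Phi_defined Q f : Prop :=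
  forall i, (i.+1 < size Q)%N ->
    let al := f (ratpt R a Q`_i) in
    bset (clip_fat Q i al) !=set0 /\
    forall x : R, ratr Q`_i < x <= ratr Q`_i.+1 ->
      bset (Phi_step Q i al x) !=set0.

Definition DQ : set (T -> IK) := [set f | continuous f].

Definition fle f g : Prop := forall x, (f x <= g x)%O.

Definition is_Dsup (S : set (T -> IK)) f : Prop :=
  [/\ DQ f, forall g, S g -> fle g f &
    forall g, DQ g -> (forall g', S g' -> fle g' g) -> fle f g].

(* The item (b, (p, r)) stands for the function b on (p, r], bottom elsewhere. *)
Definition chi (i : IK * (rat * rat)) : T -> IK := fun x =>
  if ratr i.2.1 < tval x <= ratr i.2.2 then i.1 else cbot K n 1.

Definition step_repr (s : seq (IK * (rat * rat))) th : Prop :=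
  (forall i, i \in s -> rat_box i.1) /\
  is_Dsup [set chi i | i in [set` s]] th.

Definition BD : set (T -> IK) := [set th | exists s, step_repr s th].

(* The condition does not depend on the representation s of th: it says that
   th x is way below th' x for all x. *)
Definition triB th th' : Prop :=
  [/\ BD th, BD th' & exists2 s, step_repr s th &
    forall i, i \in s -> forall x, ocint i.2 x -> way_below i.1 (th' x)].

Definition tri f g : Prop :=
  exists th1 th2, [/\ triB th1 th2, fle f th1 & fle th2 g].

Definition WD : set (set (T -> IK)) := [set phi |
  [/\ phi `<=` BD, phi !=set0,
    forall b b', triB b b' -> phi b' -> phi b &
    forall A, finite_set A -> A `<=` phi ->
      exists2 z, phi z & forall b, A b -> triB b z]].

(* intersection of all rounded ideals: the least one, as soon as it is one *)
Definition Wbot : set (T -> IK) := \bigcap_(phi in WD) phi.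

Definition is_Wsup (S : set (set (T -> IK))) psi : Prop :=
  [/\ WD psi, forall phi, S phi -> phi `<=` psi &
    forall om, WD om -> (forall phi, S phi -> phi `<=` om) -> psi `<=` om].

Definition lower_star f : set (T -> IK) := [set b | BD b /\ tri b f].

(* the join in DQ of the elements of phi, which exists when phi is directed *)
Definition upper_star phi : T -> IK := xget (fun=> cbot K n 1) (is_Dsup phi).

Definition F Q phi : set (T -> IK) :=
  lower_star (Phi Q (upper_star phi)).

Definition F_defined Q phi : Prop := Phi_defined Q (upper_star phi).

End Operators.

Arguments fat {R n K} M Q i al.
Arguments clip_fat {R n K} M Q i al.
Arguments Wbot {R} n K a.

(* Main.v *)
(* The domain I[-K,K]^n is continuous: b is way below c iff b contains the
   e-fattening of c (clipped to the cube) for some e > 0. Hence maps in D_Q are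
   those satisfying an epsilon-delta condition on half-open rational cells, the
   step functions are the maps with rational values that depend only on the
   position of the argument relative to finitely many rationals, and triangle
   on them is pointwise way-below. It follows that f |-> f_* lands in W_D for
   every f, that (f_* )^* = f for f in D_Q, and that the m-th iterate of F is
   (f_m)_*, where f_m is the m-th iterate of Phi from the constant bottom map.
   Interval arithmetic is inclusion-monotone and the speed of the Euler step is
   at most M(1 + n M1), so no clipping occurs in E^2, E^2 is a fixed point of
   Phi, and f_m is below E^2 for all m. As E^2 is computed from left to right,
   f_m and E^2 agree at q_i for i < m, whence f_(k+1) = E^2. *)

Require Import Defs.
From mathcomp Require Import all_boot all_order all_algebra.
From mathcomp Require Import all_classical all_reals all_analysis.
From mathcomp Require Import ring lra.

Set Implicit Arguments.
Unset Strict Implicit.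
Unset Printing Implicit Defensive.

Import Order.TTheory GRing.Theory Num.Theory.
Import numFieldNormedType.Exports.

Local Open Scope classical_set_scope.
Local Open Scope ring_scope.

(** If [y < x], some rational [e] lies strictly between 0 and [x - y]. Rational margins suffice
    throughout, because fattening radii are taken rational. *)
Lemma le_of_ratr_eps (R : realType) (x y : R) :
  (forall e : rat, 0 < e -> x - ratr e <= y) -> x <= y.
Proof.
move=> H; rewrite leNgt; apply/negP => yx.
have : 0 < x - y by rewrite subr_gt0.
case/rat_in_itvoo => e; rewrite in_itv/= => /andP[e0 exy].
by have := H e; rewrite -(ltr0q R) => /(_ e0); lra.
Qed.

(** * The way-below relation in a partial order *)

Section WayBelow.
Context {d : Order.disp_t} {T : porderType d}.
Implicit Types x y z : T.

Lemma way_below_le x y : way_below x y -> (x <= y)%O.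
Proof.
move=> /(_ [set y] y) [| |//|_ ->//].
  split; first by exists y.
  by move=> _ _ -> ->; exists y.
by split=> [_ ->//|z]; apply.
Qed.

Lemma way_below_le_trans x y z : way_below x y -> (y <= z)%O -> way_below x z.
Proof. by move=> xy yz S s dS sS zs; apply: xy dS sS _; exact: le_trans zs. Qed.

Lemma le_way_below_trans x y z : (x <= y)%O -> way_below y z -> way_below x z.
Proof.
move=> xy yz S s dS sS zs; have [t St yt] := yz S s dS sS zs.
by exists t => //; exact: le_trans yt.
Qed.

Lemma way_below_bot x y : (forall z, (x <= z)%O) -> way_below x y.
Proof. by move=> xbot S s [[z Sz] _] _ _; exists z. Qed.

Lemma directed_seq (S : set T) (I : eqType) (f : I -> T) (s : seq I) :
  directed S -> (forall i, i \in s -> S (f i)) ->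
  exists2 z, S z & forall i, i \in s -> (f i <= z)%O.
Proof.
move=> [[z0 Sz0] dS]; elim: s => [|i s IHs] Sf; first by exists z0.
have [|z Sz fz] := IHs; first by move=> j js; apply: Sf; rewrite inE js orbT.
have [t [St it zt]] := dS (f i) z (Sf i (mem_head _ _)) Sz.
exists t => // j; rewrite inE => /orP[/eqP -> //|/fz]; move/le_trans; exact.
Qed.

End WayBelow.

(* For validated boxes, [ble b c] says that c is included in b. *)
Definition ble (R : realType) m n (b c : box R m n) : Prop :=
  forall i j, b.1 i j <= c.1 i j /\ c.2 i j <= b.2 i j.

(** * Fattenings of boxes and the way-below relation between boxes *)

Section Fattening.
Context {R : realType} {r : {posnum rat}} {m n : nat}.
Local Notation rR := (ratr r%:num : R).
Implicit Types (b c : cbox R r m n) (e : rat).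

Lemma in_cube_bounds (b : box R m n) : in_cube rR b <->
  forall i j, [/\ - rR <= b.1 i j, b.1 i j <= b.2 i j & b.2 i j <= rR].
Proof.
split=> [H i j|H].
  by have /forallP/(_ i)/forallP/(_ j)/and3P[] := H.
by do 2!apply/forallP => ?; apply/and3P; exact: H.
Qed.

Lemma cboxP b i j : [/\ - rR <= (cval b).1 i j,
  (cval b).1 i j <= (cval b).2 i j & (cval b).2 i j <= rR].
Proof. exact: (in_cube_bounds (cval b)).1 (cvalP b) i j. Qed.

Lemma cbox_leP b c : (b <= c)%O <-> ble (cval b) (cval c).
Proof.
split=> [/asboolP/cbox_subP H i j|H]; first by have /andP[] := H i j.
apply/asboolP => x cx i j; have [? ?] := H i j.
by have /andP[? ?] := cx i j; apply/andP; lra.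
Qed.

Lemma cval_tocbox (b : box R m n) : in_cube rR b -> cval (tocbox r b) = b.
Proof. by move=> bP; rewrite /tocbox insubdK. Qed.

Lemma cbot_le b : (cbot r m n <= b)%O.
Proof.
by apply/cbox_leP => i j; rewrite !mxE; have [] := cboxP b i j.
Qed.

Lemma ble_bclip (b c : box R m n) : ble b c -> ble (bclip rR b) (bclip rR c).
Proof.
move=> bc i j; have [? ?] := bc i j; rewrite !mxE.
by split; [rewrite ge_max !le_max lexx orbT andbT|
           rewrite le_min !ge_min lexx orbT andbT]; apply/orP; left.
Qed.

Lemma bclip_id (b : box R m n) : in_cube rR b -> bclip rR b = b.
Proof.
move/in_cube_bounds => H; rewrite /bclip [RHS]surjective_pairing.
congr pair; apply/matrixP => i j; rewrite mxE; have [h1 h2 h3] := H i j.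
  by apply/max_idPl.
by apply/min_idPl.
Qed.

(** The clipped box still contains [c], so it is not empty. *)
Lemma in_cube_bclip (b c : box R m n) :
  ble b c -> in_cube rR c -> in_cube rR (bclip rR b).
Proof.
move=> bc /in_cube_bounds cP; apply/in_cube_bounds => i j.
have [? ?] := bc i j; have [? ? ?] := cP i j; rewrite !mxE.
by rewrite !(ge_max, le_max, ge_min, le_min); split; lra.
Qed.

Lemma ble_bfatten (b : box R m n) e : 0 <= e -> ble (bfatten b (ratr e)) b.
Proof.
by rewrite -(ler0q R) => e0 i j; rewrite !mxE; lra.
Qed.

(** A rational radius makes the fattening of a rational box rational. For [0 <= e] the default of
    [tocbox] is never reached, since the clipped box contains [b]. *)
Definition cfat e b : cbox R r m n := tocbox r (bclip rR (bfatten b (ratr e))).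

Lemma cval_cfat e b : 0 <= e ->
  cval (cfat e b) = bclip rR (bfatten b (ratr e)).
Proof.
move=> e0; rewrite cval_tocbox//.
by apply: in_cube_bclip (cvalP b); exact: ble_bfatten.
Qed.

(** The clipping leaves no trace in this criterion, because [c] lies in the cube anyway. *)
Lemma cfatP e b c : 0 <= e -> (cfat e b <= c)%O <-> forall i j,
  (cval b).1 i j - ratr e <= (cval c).1 i j /\
  (cval c).2 i j <= (cval b).2 i j + ratr e.
Proof.
move=> e0; rewrite cbox_leP cval_cfat//; split=> H i j.
all: have := H i j; rewrite !mxE !(ge_max, le_max, ge_min, le_min).
  by case=> /andP[-> _] /andP[-> _].
by case=> -> ->; have [-> _ ->] := cboxP c i j.
Qed.

(** Clipping is a maximum or minimum with a constant, so it does not increase the distance between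
    bounds. This carries Lipschitz estimates for unclipped Taylor steps over to clipped ones. *)
Lemma cfat_bclip e (b c : box R m n) : 0 <= e ->
  in_cube rR (bclip rR b) -> in_cube rR (bclip rR c) ->
  (forall i j, b.1 i j - ratr e <= c.1 i j /\ c.2 i j <= b.2 i j + ratr e) ->
  (cfat e (tocbox r (bclip rR b)) <= tocbox r (bclip rR c))%O.
Proof.
move=> e0 bP cP bc; apply/cfatP => // i j; rewrite !cval_tocbox// !mxE.
have [? ?] := bc i j; have eR : 0 <= ratr e :> R by rewrite ler0q.
split.
  rewrite lerBlDr ge_max; apply/andP; split.
    by rewrite -lerBlDr le_max; apply/orP; left.
  by rewrite -lerBlDr le_max; apply/orP; right; lra.
rewrite -lerBlDr le_min; apply/andP; split.
  by rewrite lerBlDr ge_min; apply/orP; left.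
by rewrite lerBlDr ge_min; apply/orP; right; lra.
Qed.

Lemma cfat_le e b : 0 <= e -> (cfat e b <= b)%O.
Proof.
by move=> e0; apply/cfatP => // i j; move: e0; rewrite -(ler0q R); lra.
Qed.

Lemma cfat_mono e b c : 0 <= e -> (b <= c)%O -> (cfat e b <= cfat e c)%O.
Proof.
move=> e0 /cbox_leP bc; apply/cbox_leP; rewrite !cval_cfat//.
by apply: ble_bclip => i j; have [? ?] := bc i j; rewrite !mxE; lra.
Qed.

Lemma cfat_anti e e' b : 0 <= e -> e <= e' -> (cfat e' b <= cfat e b)%O.
Proof.
move=> e0 ee'; have e'0 := le_trans e0 ee'.
apply/cbox_leP; rewrite !cval_cfat//.
apply: ble_bclip => i j; rewrite !mxE.
by have : ratr e <= ratr e' :> R; [rewrite ler_rat|lra].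
Qed.

(** Clipping after the first half can only make the result smaller. Splitting a margin in this way
    is the source of interpolation for [way_below]. *)
Lemma cfat_half e b : 0 <= e -> (cfat e b <= cfat (e / 2) (cfat (e / 2) b))%O.
Proof.
move=> e0; have e20 : 0 <= e / 2 by rewrite divr_ge0.
have eE : ratr e = ratr (e / 2) + ratr (e / 2) :> R.
  by rewrite -rmorphD /=; congr ratr; lra.
have e2R : 0 <= ratr (e / 2) :> R by rewrite ler0q.
apply/cbox_leP; rewrite !cval_cfat//; apply: ble_bclip => i j.
rewrite !mxE eE.
by rewrite /Num.max /Num.min; split; do 2!case: ltP; lra.
Qed.

Lemma cfat_directed b : directed [set cfat e b | e in [set e : rat | 0 < e]].
Proof.
split; first by exists (cfat 1 b), 1.
move=> _ _ [e e0 <-] [e' e'0 <-]; exists (cfat (Num.min e e') b); split.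
- by exists (Num.min e e') => //=; rewrite lt_min; apply/andP.
- by apply: cfat_anti; rewrite ?le_min ?ge_min ?lexx// !ltW.
- by apply: cfat_anti; rewrite ?le_min ?ge_min ?lexx ?orbT// !ltW.
Qed.

(** The fattenings of [b] thus form a directed family with supremum [b]; testing Scott-open sets and
    [way_below] on this family reduces both to statements about radii. *)
Lemma cfat_sup b : supremums [set cfat e b | e in [set e : rat | 0 < e]] b.
Proof.
split=> [_ [e e0 <-]|c cub]; first exact/cfat_le/ltW.
apply/cbox_leP => i j; split; apply: le_of_ratr_eps => e e0.
all: have /cub/cfatP : [set cfat e b | e in [set e : rat | 0 < e]] (cfat e b)
  by exists e.
all: by move=> /(_ (ltW e0) i j)[]; lra.
Qed.

Lemma scott_open_cfat (U : set (cbox R r m n)) b : scott_open U -> U b ->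
  exists2 e : rat, 0 < e & U (cfat e b).
Proof.
move=> [_ Uin] Ub; have [_ [[e e0 <-] Ue]] :=
  Uin _ _ (cfat_directed b) (cfat_sup b) Ub.
by exists e.
Qed.

(* A supremum s of S is approached coordinatewise by S: otherwise moving the
   bound of s in one coordinate would give a smaller upper bound. *)
Lemma supremum_approx (S : set (cbox R r m n)) s (e : rat) :
  S !=set0 -> supremums S s -> 0 < e -> forall i j,
  (exists2 c, S c & (cval s).1 i j - ratr e <= (cval c).1 i j) /\
  (exists2 c, S c & (cval c).2 i j <= (cval s).2 i j + ratr e).
Proof.
move=> [c0 Sc0] [sub slub] e0 i j.
have e0R : 0 < ratr e :> R by rewrite ltr0q.
split; apply: contrapT => H.
- pose v : 'M[R]_(m, n) := \matrix_(i', j')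
    if (i' == i) && (j' == j) then Num.max (- rR) ((cval s).1 i j - ratr e)
    else (cval s).1 i' j'.
  have sP : in_cube rR (v, (cval s).2).
    apply/in_cube_bounds => i' j'; rewrite !mxE; case: ifPn => [|_].
      move=> /andP[/eqP -> /eqP ->]; have [? ? ?] := cboxP s i j.
      by rewrite !(ge_max, le_max) lexx; split=> //; lra.
    exact: cboxP.
  have : (s <= tocbox r (v, (cval s).2))%O.
    apply: slub => c Sc; apply/cbox_leP; rewrite cval_tocbox// => i' j' /=.
    have /cbox_leP/(_ i' j')[cs1 cs2] := sub _ Sc.
    rewrite !mxE; split=> //; case: ifPn => //.
    move=> /andP[/eqP -> /eqP ->]; rewrite le_max; apply/orP; right.
    by rewrite leNgt; apply/negP => sc; apply: H; exists c => //; exact: ltW.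
  move=> /cbox_leP; rewrite cval_tocbox// => /(_ i j)[+ _].
  rewrite /= !mxE !eqxx /= le_max => /orP[|]; last lra.
  (* Here the bound of [s] is already the extreme value [- rR], so any element of the non-empty set
     [S] approximates it. *)
  move=> sr; apply: H; exists c0 => //; have [? _ _] := cboxP c0 i j; lra.
- pose v : 'M[R]_(m, n) := \matrix_(i', j')
    if (i' == i) && (j' == j) then Num.min rR ((cval s).2 i j + ratr e)
    else (cval s).2 i' j'.
  have sP : in_cube rR ((cval s).1, v).
    apply/in_cube_bounds => i' j'; rewrite !mxE; case: ifPn => [|_].
      move=> /andP[/eqP -> /eqP ->]; have [? ? ?] := cboxP s i j.
      by rewrite !(ge_min, le_min) lexx; split=> //; lra.
    exact: cboxP.
  have : (s <= tocbox r ((cval s).1, v))%O.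
    apply: slub => c Sc; apply/cbox_leP; rewrite cval_tocbox// => i' j' /=.
    have /cbox_leP/(_ i' j')[cs1 cs2] := sub _ Sc.
    rewrite !mxE; split=> //; case: ifPn => //.
    move=> /andP[/eqP -> /eqP ->]; rewrite ge_min; apply/orP; right.
    by rewrite leNgt; apply/negP => sc; apply: H; exists c => //; exact: ltW.
  move=> /cbox_leP; rewrite cval_tocbox// => /(_ i j)[_ +].
  rewrite /= !mxE !eqxx /= ge_min => /orP[|]; last lra.
  move=> sr; apply: H; exists c0 => //; have [_ _ ?] := cboxP c0 i j; lra.
Qed.

(** Each of the finitely many endpoint coordinates of [s] is approached within [e] by some element
    of [S]; a common upper bound in [S] of these elements approaches all of them at once. *)
Lemma cfat_way_below e b : 0 < e -> way_below (cfat e b) b.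
Proof.
move=> e0 S s dS sS /cbox_leP bs.
have /choice[f fP] : forall ij : 'I_m * 'I_n, 
      exists c : cbox R r m n * cbox R r m n,
    [/\ S c.1, S c.2, (cval s).1 ij.1 ij.2 - ratr e <= (cval c.1).1 ij.1 ij.2 &
    (cval c.2).2 ij.1 ij.2 <= (cval s).2 ij.1 ij.2 + ratr e].
  move=> [i j]; have [[c Sc h] [c' Sc' h']] := supremum_approx dS.1 sS e0 i j.
  by exists (c, c').
have [|z1 Sz1 z1P] := directed_seq (f := fun ij => (f ij).1)
    (s := enum {: 'I_m * 'I_n}) dS.
  by move=> ij _; have [] := fP ij.
have [|z2 Sz2 z2P] := directed_seq (f := fun ij => (f ij).2)
    (s := enum {: 'I_m * 'I_n}) dS.
  by move=> ij _; have [] := fP ij.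
have [z [Sz z1z z2z]] := dS.2 z1 z2 Sz1 Sz2.
exists z => //; apply/cfatP; first exact: ltW.
move=> i j; have [? ?] := bs i j; have /= [_ _ ? ?] := fP (i, j).
have /cbox_leP/(_ i j)/=[? ?] := z1P (i, j) (mem_enum _ _).
have /cbox_leP/(_ i j)/=[? ?] := z2P (i, j) (mem_enum _ _).
move: z1z z2z => /cbox_leP/(_ i j)[? ?] /cbox_leP/(_ i j)[? ?].
by split; lra.
Qed.

Lemma way_belowP b c :
  way_below b c <-> exists2 e : rat, 0 < e & (b <= cfat e c)%O.
Proof.
split=> [bc|[e e0 be]]; last first.
  by apply: (le_way_below_trans be); exact: cfat_way_below.
have [_ [e e0 <-] be] := bc _ _ (cfat_directed c) (cfat_sup c) (lexx _).
by exists e.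
Qed.

(** Half of the margin [e] pays for replacing [s] by an element of [S]; the other half remains as
    the margin of that element. *)
Lemma scott_open_way_below b : scott_open (way_below b).
Proof.
split=> [x y|S s dS sS]; first exact: way_below_le_trans.
move=> /way_belowP[e e0 be]; have e20 : 0 < e / 2 by rewrite divr_gt0.
have [z Sz ez] := cfat_way_below e20 dS sS (lexx s).
exists z; split; first exact: Sz.
apply/way_belowP; exists (e / 2); first exact: e20.
apply: le_trans be _; apply: le_trans (cfat_half s (ltW e0)) _.
exact: cfat_mono (ltW e20) ez.
Qed.

End Fattening.

(** The boxes not below [f c] form a Scott-open set. Its preimage is an upper set, so if it
    contained [b] it would contain [c], which is absurd. *)
Lemma scott_continuous_homo (R : realType) (r r' : {posnum rat}) m n m' n'
    (f : cbox R r m n -> cbox R r' m' n') :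
  continuous f -> forall b c, (b <= c)%O -> (f b <= f c)%O.
Proof.
move=> fc b c bc; apply: contrapT => fbc.
have oV : open [set x | ~ (x <= f c)%O].
  split=> [x y xfc xy yfc|S s dS sS sfc].
    by apply: xfc; exact: le_trans yfc.
  apply: contrapT => SfcN; apply: sfc; apply: sS.2 => x Sx.
  by apply: contrapT => xfc; apply: SfcN; exists x.
have [Uup _] : open (f @^-1` [set x | ~ (x <= f c)%O]).
  by apply: open_comp => // x _; exact: fc.
have /= := Uup b c fbc bc; exact.
Qed.

Local Notation tval := Defs.tval.

(** * Continuous maps on half-open cells, and step functions *)

Section StepFunctions.
Context {R : realType} {n : nat} {K a : {posnum rat}}.
Local Notation T := (time R a).
Local Notation IK := (cbox R K n 1).
Implicit Types (f g th : T -> IK) (e : rat).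

Lemma nbhs_timeP (x : T) A :
  nbhs x A <-> exists2 pq, ocint pq x & ocint pq `<=` A.
Proof.
rewrite nbhsE; split=> [[B [[D' _ <-] [pq D'pq pqx]] BA]|[pq pqx pqA]].
  by exists pq => // y pqy; apply: BA; exists pq.
exists (ocint pq) => //; split=> //; exists [set pq] => //.
by rewrite bigcup_set1.
Qed.

(** The boxes that [cfat e (f x)] is way below form an open neighbourhood of [f x], and by
    [scott_open_cfat] every open neighbourhood of [f x] contains all boxes above some fattening. *)
Lemma DQP f : DQ f <-> forall x e, 0 < e ->
  exists2 pq, ocint pq x & forall y, ocint pq y -> (cfat e (f x) <= f y)%O.
Proof.
split=> [fc x e e0|H x].
  have : nbhs (f x) (way_below (cfat e (f x))).
    by apply: open_nbhs_nbhs; split;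
      [exact: scott_open_way_below|exact: cfat_way_below].
  move=> /fc/nbhs_timeP[pq pqx pqA]; exists pq => // y /pqA.
  exact: way_below_le.
move=> A; rewrite nbhsE => -[U [oU Ux] UA].
have [e e0 Ue] := scott_open_cfat oU Ux; have [pq pqx pqf] := H x e e0.
apply/nbhs_timeP; exists pq => // y /pqf fy; apply: UA.
exact: oU.1 Ue fy.
Qed.

Lemma fle_trans g f h : fle f g -> fle g h -> fle f h.
Proof. by move=> fg gh x; exact: le_trans (gh x). Qed.

Lemma fle_anti f g : fle f g -> fle g f -> f = g.
Proof. by move=> fg gf; apply/funext => x; apply/le_anti; rewrite fg gf. Qed.

(** The intersection of two boxes. For disjoint boxes [tocbox] falls back to bottom, so [cjoinP]
    asks for a common upper bound [d]. *)
Definition cjoin (b c : IK) : IK := tocbox K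
  (\matrix_(i, j) Num.max ((cval b).1 i j) ((cval c).1 i j),
   \matrix_(i, j) Num.min ((cval b).2 i j) ((cval c).2 i j)).

Lemma cjoinP (b c d : IK) : (b <= d)%O -> (c <= d)%O ->
  forall z, (cjoin b c <= z)%O <-> (b <= z)%O /\ (c <= z)%O.
Proof.
move=> /cbox_leP bd /cbox_leP cd z.
rewrite !cbox_leP cval_tocbox; last first.
  apply/in_cube_bounds => i j; have [? ? ?] := cboxP b i j.
  have [? ? ?] := cboxP c i j; have [? ? ?] := cboxP d i j.
  have [? ?] := bd i j; have [? ?] := cd i j.
  rewrite !mxE !(ge_max, le_max, le_min, ge_min); split.
  - by apply/orP; left.
  - by apply/andP; split; apply/andP; split; lra.
  - by apply/orP; left.
split=> [H|[bz cz] i j].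
  by split=> i j; have := H i j; rewrite !mxE ge_max le_min;
    case=> /andP[? ?] /andP[? ?].
by have [? ?] := bz i j; have [? ?] := cz i j; rewrite !mxE ge_max le_min;
  split; apply/andP.
Qed.

Lemma rat_cbot : rat_box (cbot K n 1 : IK).
Proof.
exists (const_mx (- K%:num)), (const_mx K%:num); congr pair.
  by apply/matrixP => i j; rewrite !mxE rmorphN.
by apply/matrixP => i j; rewrite !mxE.
Qed.

Lemma rat_tocbox (b : box R n 1) (l h : 'cV[rat]_n) :
  b = (map_mx ratr l, map_mx ratr h) -> rat_box (tocbox K b : IK).
Proof.
move=> ->; rewrite /tocbox /insubd.
case: insubP => [c _ cE|_]; last exact: rat_cbot.
by exists l, h.
Qed.

Lemma ratr_max (x y : rat) :
  ratr (Num.max x y) = Num.max (ratr x) (ratr y) :> R.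
Proof.
by case: (leP x y) => xy; [rewrite max_r|rewrite max_l] => //;
  rewrite ler_rat // ltW.
Qed.

Lemma ratr_min (x y : rat) :
  ratr (Num.min x y) = Num.min (ratr x) (ratr y) :> R.
Proof.
by case: (leP x y) => xy; [rewrite min_l|rewrite min_r] => //;
  rewrite ler_rat // ltW.
Qed.

Lemma rat_cjoin (b c : IK) : rat_box b -> rat_box c -> rat_box (cjoin b c).
Proof.
move=> [l [h bE]] [l' [h' cE]]; rewrite /cjoin bE cE /=.
apply: (@rat_tocbox _ (\matrix_(i, j) Num.max (l i j) (l' i j))
  (\matrix_(i, j) Num.min (h i j) (h' i j))); congr pair.
  by apply/matrixP => i j; rewrite !mxE ratr_max.
by apply/matrixP => i j; rewrite !mxE ratr_min.
Qed.

Lemma rat_cfat e (b : IK) : rat_box b -> rat_box (cfat e b).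
Proof.
move=> [l [h bE]]; rewrite /cfat bE.
apply: (@rat_tocbox _ (\matrix_(i, j) Num.max (l i j - e) (- K%:num))
  (\matrix_(i, j) Num.min (h i j + e) K%:num)); congr pair.
  by apply/matrixP => i j; rewrite !mxE ratr_max rmorphB rmorphN.
by apply/matrixP => i j; rewrite !mxE ratr_min rmorphD.
Qed.

(** Membership in [(p, q]] is decided by the comparisons with [p] and [q] alone, so a map built from
    finitely many such intervals is constant on these classes. *)
Definition same_cell (cs : seq rat) (x y : T) : Prop :=
  forall c, c \in cs -> (tval x <= ratr c) = (tval y <= ratr c).

(** The endpoints -1 and [a] ensure that every time, 0 included, is covered. Empty pairs and pairs
    crossing other cut points occur as well. *)
Definition cells (cs : seq rat) : seq (rat * rat) :=
  [seq (p, q) | p <- -1 :: cs, q <- a%:num :: cs].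

(** By induction on [cs]: each new cut point shrinks the interval around [x] on the left or on the
    right, according to its position relative to [x]. *)
Lemma cellsP cs x : exists2 pq, pq \in cells cs &
  ocint pq x /\ forall y, ocint pq y -> same_cell cs x y.
Proof.
suff [p [q [pcs qcs pqx H]]] : exists p q, [/\ p \in -1 :: cs,
    q \in a%:num :: cs, ocint (p, q) x &
    forall y, ocint (p, q) y -> same_cell cs x y].
  by exists (p, q) => //; apply/allpairsP; exists (p, q).
elim: cs => [|c cs [p [q [pcs qcs pqx H]]]].
  exists (-1), a%:num; rewrite !inE !eqxx; split=> //.
  rewrite /ocint /=; have /andP[x0 ->] := tvalP x.
  by rewrite andbT (lt_le_trans _ x0) // ltrq0.
move: pqx; rewrite /ocint /= => /andP[px xq].
have [xc|cx] := leP (tval x) (ratr c).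
  exists p, (Num.min q c); split.
  - by move: pcs; rewrite !inE => /orP[->//|->]; rewrite !orbT.
  - rewrite /Num.min; case: ifP => _; last by rewrite !inE eqxx orbT.
    by move: qcs; rewrite !inE => /orP[->//|->]; rewrite !orbT.
  - by rewrite px ratr_min le_min xq xc.
  - move=> y; rewrite ratr_min le_min => /andP[py /andP[yq yc]] c'.
    rewrite inE => /orP[/eqP -> |]; first by rewrite xc yc.
    by apply: H; rewrite /ocint /= py yq.
exists (Num.max p c), q; split.
- rewrite /Num.max; case: ifP => _; first by rewrite !inE eqxx orbT.
  by move: pcs; rewrite !inE => /orP[->//|->]; rewrite !orbT.
- by move: qcs; rewrite !inE => /orP[->//|->]; rewrite !orbT.
- by rewrite ratr_max gt_max px cx xq.
- move=> y; rewrite ratr_max gt_max => /andP[/andP[py cy] yq] c'.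
  rewrite inE => /orP[/eqP -> |].
    by rewrite !leNgt cx cy.
  by apply: H; rewrite /ocint /= py yq.
Qed.

(** An intrinsic description of the elements of [BD], free of any representation as a supremum;
    [BDP] proves the equivalence. *)
Definition simple th : Prop := (forall x, rat_box (th x)) /\
  exists cs, forall x y, same_cell cs x y -> th x = th y.

Lemma simple_DQ th : simple th -> DQ th.
Proof.
move=> [_ [cs thE]]; apply/DQP => x e e0.
have [pq _ [pqx pqcs]] := cellsP cs x; exists pq => // y /pqcs/thE <-.
exact/cfat_le/ltW.
Qed.

Lemma simple_cbot : simple (fun=> cbot K n 1).
Proof. by split=> [_|]; [exact: rat_cbot|exists [::]]. Qed.

Lemma simple_chi (i : IK * (rat * rat)) : rat_box i.1 -> simple (chi i).
Proof.
move=> ratb; split=> [x|].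
  by rewrite /chi; case: ifP => _ //; exact: rat_cbot.
exists [:: i.2.1; i.2.2] => x y xy; rewrite /chi !ltNge !xy//.
all: by rewrite !inE eqxx ?orbT.
Qed.

Lemma simple_cjoin f g : simple f -> simple g ->
  simple (fun x => cjoin (f x) (g x)).
Proof.
move=> [fr [cs fE]] [gr [cs' gE]]; split=> [x|]; first exact: rat_cjoin.
exists (cs ++ cs') => x y xy; rewrite (fE x y) ?(gE x y)// => c ccs.
all: by apply: xy; rewrite mem_cat ccs ?orbT.
Qed.

Lemma simple_cfat e f : simple f -> simple (fun x => cfat e (f x)).
Proof.
move=> [fr [cs fE]]; split=> [x|]; first exact: rat_cfat.
by exists cs => x y /fE ->.
Qed.

Definition joins (s : seq (IK * (rat * rat))) : T -> IK :=
  fun x => foldr (fun i c => cjoin (chi i x) c) (cbot K n 1) s.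

(** The common bound [d] at [x] makes all partial joins there intersections of boxes that meet, so
    [cjoin] never takes its default value. *)
Lemma joinsP s (x : T) (d : IK) : (forall i, i \in s -> (chi i x <= d)%O) ->
  forall z, (joins s x <= z)%O <-> forall i, i \in s -> (chi i x <= z)%O.
Proof.
elim: s => [_ z|i s IHs sd z] /=; first by split=> // _; exact: cbot_le.
have {}IHs : forall z, (joins s x <= z)%O <->
    forall i, i \in s -> (chi i x <= z)%O.
  by apply: IHs => j js; apply: sd; rewrite inE js orbT.
have ixd : (chi i x <= d)%O by apply: sd; exact: mem_head.
have sxd : (joins s x <= d)%O.
  by apply/IHs => j js; apply: sd; rewrite inE js orbT.
rewrite (cjoinP ixd sxd); split=> [[iz /IHs sz] j|sz].
  by rewrite inE => /orP[/eqP ->//|/sz].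
split; first by apply: sz; exact: mem_head.
by apply/IHs => j js; apply: sz; rewrite inE js orbT.
Qed.

Lemma simple_joins s : (forall i, i \in s -> rat_box i.1) -> simple (joins s).
Proof.
elim: s => [_|i s IHs sr]; first exact: simple_cbot.
apply: simple_cjoin; first by apply: simple_chi; apply: sr; exact: mem_head.
by apply: IHs => j js; apply: sr; rewrite inE js orbT.
Qed.

(** The pointwise join is itself a member of [DQ], hence the supremum in [DQ] is computed
    pointwise. *)
Lemma step_repr_joins s th : step_repr s th -> th = joins s.
Proof.
move=> [sr [_ ubth lubth]].
have sth x i : i \in s -> (chi i x <= th x)%O.
  by move=> si; apply: ubth; exists i.
apply: fle_anti.
  apply: lubth => [|_ [i /= si <-] x]; first exact/simple_DQ/simple_joins.
  have /(_ (joins s x)) := joinsP (sth x).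
  by rewrite lexx => -[/(_ isT)/(_ i si)].
by move=> x; apply/(joinsP (sth x)) => i; exact: sth.
Qed.

Lemma BDP th : BD th <-> simple th.
Proof.
split=> [[s srth]|sth].
  by rewrite (step_repr_joins srth); apply: simple_joins; exact: srth.1.
have [thr [cs thE]] := sth.
pose pt pq := xget (time0 a : T) (ocint pq : set T).
(* Only the pairs on which [th] is constant are kept. An empty pair gets the value at the default
   point, which is harmless since its [chi] is bottom everywhere. *)
pose s := [seq (th (pt pq), pq) | pq <- cells cs &
  `[< forall x, ocint pq x -> th x = th (pt pq) >]].
have sP i : i \in s -> rat_box i.1 /\ forall x, ocint i.2 x -> th x = i.1.
  move=> /mapP[pq]; rewrite mem_filter => /andP[/asboolP pqth _] ->.
  by split=> //; exact: thr.
exists s; split; first by move=> i /sP[].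
split; first exact: simple_DQ.
  move=> _ [i /= /sP[_ ith] <-] x; rewrite /chi; case: ifP => [/ith->//|_].
  exact: cbot_le.
move=> g _ gub x; have [pq pqcs [pqx pqE]] := cellsP cs x.
have ptE y : ocint pq y -> th y = th x by move=> /pqE/thE.
have ptx : th (pt pq) = th x.
  by apply: ptE; apply: (@xgetPex _ _ (ocint pq)); exists x.
have sx : (th x, pq) \in s.
  rewrite -ptx; apply/mapP; exists pq => //; rewrite mem_filter pqcs andbT.
  by apply/asboolP => y /ptE ->.
have := gub (chi (th x, pq)) (ex_intro2 _ _ (th x, pq) sx erefl) x.
by rewrite /chi /= ifT.
Qed.

(** At each time [th x] is a join of finitely many boxes way below [th' x], and such a join is again
    way below [th' x]. *)
Lemma triBP th th' : triB th th' <->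
  [/\ BD th, BD th' & forall x, way_below (th x) (th' x)].
Proof.
split=> [[Bth Bth' [s srth sth']]|[[s srth] Bth' thth']]; split=> //.
- move=> x S z dS zS thz; rewrite (step_repr_joins srth).
  have iP (i : IK * (rat * rat)) : exists c, i \in s -> S c /\ (chi i x <= c)%O.
    have [si|_] := boolP (i \in s); last by exists (cbot K n 1).
    have [c Sc ic] : exists2 c, S c & (chi i x <= c)%O; last by exists c.
    rewrite /chi; case: ifP => [ix|_].
      exact: sth' dS zS thz.
    by have [[c Sc] _] := dS; exists c => //; exact: cbot_le.
  have /choice[c cP] := iP.
  have [|t St st] := directed_seq (f := c) (s := s) dS; first by move=> i /cP[].
  have sxt i : i \in s -> (chi i x <= t)%O.
    by move=> si; apply: le_trans (cP i si).2 (st i si).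
  by exists t => //; apply/(joinsP sxt).
- by exists s.
exists s => // i si x ix.
apply: le_way_below_trans (thth' x).
have [_ ub _] := srth.2; have := ub (chi i) (ex_intro2 _ _ i si erefl) x.
by rewrite /chi ifT.
Qed.

End StepFunctions.

Lemma uniform_eps (I : eqType) (P : I -> rat -> Prop) (s : seq I) :
  (forall i e e', 0 < e -> e <= e' -> P i e' -> P i e) ->
  (forall i, i \in s -> exists2 e, 0 < e & P i e) ->
  exists2 e, 0 < e & forall i, i \in s -> P i e.
Proof.
move=> Panti; elim: s => [|i s IHs] sP; first by exists 1.
have [|e e0 se] := IHs; first by move=> j js; apply: sP; rewrite inE js orbT.
have [e' e'0 ie'] := sP i (mem_head _ _).
have m0 : 0 < Num.min e e' by rewrite lt_min e0.
exists (Num.min e e') => // j; rewrite inE => /orP[/eqP ->|/se je].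
  by apply: Panti ie'; rewrite // ge_min lexx orbT.
by apply: Panti je; rewrite // ge_min lexx.
Qed.

(** * Rounded ideals and the passage between them and maps *)

Section Ideals.
Context {R : realType} {n : nat} {K a : {posnum rat}}.
Local Notation T := (time R a).
Local Notation IK := (cbox R K n 1).
Implicit Types (f g th : T -> IK) (e : rat) (phi : set (T -> IK)).

(** On the cells of the merged cut lists both maps are constant, so only finitely many radii occur
    and their minimum is positive. *)
Lemma simple_way_below f g : simple f -> simple g ->
  (forall x, way_below (f x) (g x)) ->
  exists2 e, 0 < e & forall x, (f x <= cfat e (g x))%O.
Proof.
move=> [_ [cs fE]] [_ [cs' gE]] fg.
pose pt pq := xget (time0 a : T) (ocint pq : set T).
have [x e e' e0 ee' fge'|x _|e e0 eP] := @uniform_eps _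
  (fun x e => f x <= cfat e (g x))%O
  [seq pt pq | pq <- cells (a := a) (cs ++ cs')].
- by apply: le_trans fge' _; apply: cfat_anti => //; exact: ltW.
- exact/way_belowP.
exists e => // x; have [pq pqcs [pqx pqE]] := cellsP (cs ++ cs') x.
have /pqE ptE : ocint pq (pt pq) by apply: (@xgetPex _ _ (ocint pq)); exists x.
rewrite (fE x (pt pq)); last first.
  by move=> c ccs; apply: ptE; rewrite mem_cat ccs.
rewrite (gE x (pt pq)); last first.
  by move=> c ccs; apply: ptE; rewrite mem_cat ccs orbT.
by apply: eP; apply: map_f.
Qed.

(** One intermediate step function is enough: the lower one in [tri] can be taken to be [b]
    itself. *)
Lemma lower_starP f b : lower_star f b <-> simple b /\
  exists2 g, simple g /\ fle g f & forall x, way_below (b x) (g x).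
Proof.
split=> [[/BDP sb [th1 [th2 [/triBP[_ /BDP sth2 th12] bth1 th2f]]]]|].
  by split=> //; exists th2 => // x; apply: le_way_below_trans (th12 x).
move=> [sb [g [sg gf] bg]]; split; first exact/BDP.
by exists b, g; split=> //; apply/triBP; split=> //; exact/BDP.
Qed.

Lemma lower_star_homo f g : fle f g -> lower_star f `<=` lower_star g.
Proof.
move=> fg b /lower_starP[sb [h [sh hf] bh]]; apply/lower_starP; split=> //.
by exists h => //; split=> //; exact: fle_trans fg.
Qed.

(** The witnesses for the single [b] all lie below [f], hence are consistent and have a pointwise
    join. *)
Lemma simple_directed_bound (s : seq (T -> IK)) f :
  (forall b, b \in s -> lower_star f b) ->
  exists2 g, simple g /\ fle g f & forall b, b \in s ->
    forall x, way_below (b x) (g x).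
Proof.
elim: s => [_|b s IHs sf].
  exists (fun=> cbot K n 1) => //.
  by split=> [|x]; [exact: simple_cbot|exact: cbot_le].
have [|g [sg gf] sg'] := IHs.
  by move=> c cs; apply: sf; rewrite inE cs orbT.
have [h [sh hf] bh] := ((lower_starP _ _).1 (sf b (mem_head _ _))).2.
have gh x := (cjoinP (gf x) (hf x) _).1 (lexx (cjoin (g x) (h x))).
exists (fun x => cjoin (g x) (h x)).
  split=> [|x]; first exact: simple_cjoin.
  by apply/(cjoinP (gf x) (hf x)).
move=> c; rewrite inE => /orP[/eqP ->|cs] x.
  exact: way_below_le_trans (bh x) (gh x).2.
exact: way_below_le_trans (sg' c cs x) (gh x).1.
Qed.

(** With a radius [e] common to all [b], the fattening of [g] by [e / 2] lies strictly in
    between. *)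
Lemma simple_interpolation (s : seq (T -> IK)) g : simple g ->
  (forall b, b \in s -> simple b) ->
  (forall b, b \in s -> forall x, way_below (b x) (g x)) ->
  exists2 z, simple z & (forall x, way_below (z x) (g x)) /\
    forall b, b \in s -> forall x, way_below (b x) (z x).
Proof.
move=> sg ss sbg.
have [b e e' e0 ee' be' x|b bs|e e0 eP] := @uniform_eps _
  (fun b e => forall x, b x <= cfat e (g x))%O s.
- by apply: le_trans (be' x) _; apply: cfat_anti => //; exact: ltW.
- by apply: simple_way_below; [exact: ss|exact: sg|exact: sbg].
have e20 : 0 < e / 2 by rewrite divr_gt0.
exists (fun x => cfat (e / 2) (g x)); first exact: simple_cfat.
split=> [x|b bs x]; first exact: cfat_way_below.
apply/way_belowP; exists (e / 2) => //.
by apply: le_trans (eP b bs x) _; exact/cfat_half/ltW.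
Qed.

Lemma WD_lower_star f : WD (lower_star f).
Proof.
split.
- by move=> b [].
- exists (fun=> cbot K n 1); apply/lower_starP.
  split; first exact: simple_cbot.
  exists (fun=> cbot K n 1); last first.
    by move=> x; apply: way_below_bot => z; exact: cbot_le.
  by split; [exact: simple_cbot|move=> x; exact: cbot_le].
- move=> b b' /triBP[/BDP sb /BDP sb' bb'] /lower_starP[_ [g [sg gf] b'g]].
  apply/lower_starP; split=> //; exists g => // x.
  exact: le_way_below_trans (way_below_le (bb' x)) (b'g x).
- move=> A /finite_seqP[s ->] sf.
  have [g [sg gf] sg'] := simple_directed_bound sf.
  have ss b : b \in s -> simple b by move=> /sf/lower_starP[].
  have [z sz [zg sz']] := simple_interpolation sg ss sg'.
  exists z; first by apply/lower_starP; split=> //; exists g.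
  by move=> b bs; apply/triBP; split; [exact/BDP/ss|exact/BDP|exact: sz'].
Qed.

(** Every endpoint is moved outwards to a rational at distance between [e / 2] and [e], and the
    result is clipped. *)
Lemma rat_approx (b : IK) e : 0 < e ->
  exists2 c, rat_box c & (cfat e b <= c)%O /\ (c <= cfat (e / 2) b)%O.
Proof.
move=> e0; have e2E : ratr e = ratr (e / 2) + ratr (e / 2) :> R.
  by rewrite -rmorphD /=; congr ratr; lra.
have e20 : 0 < e / 2 by rewrite divr_gt0.
have e2R : 0 < ratr (e / 2) :> R by rewrite ltr0q.
have /choice[l lP] : forall i : 'I_n, exists q : rat,
    (cval b).1 i 0 - ratr e < ratr q < (cval b).1 i 0 - ratr (e / 2).
  move=> i; have [|q] := @rat_in_itvoo R ((cval b).1 i 0 - ratr e)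
    ((cval b).1 i 0 - ratr (e / 2)); first lra.
  by rewrite in_itv/=; exists q.
have /choice[h hP] : forall i : 'I_n, exists q : rat,
    (cval b).2 i 0 + ratr (e / 2) < ratr q < (cval b).2 i 0 + ratr e.
  move=> i; have [|q] := @rat_in_itvoo R ((cval b).2 i 0 + ratr (e / 2))
    ((cval b).2 i 0 + ratr e); first lra.
  by rewrite in_itv/=; exists q.
pose B : box R n 1 := (\col_i ratr (l i), \col_i ratr (h i)).
have Bb : ble B (cval b).
  move=> i j; rewrite !mxE !ord1; have /andP[? ?] := lP i.
  by have /andP[? ?] := hP i; split; lra.
have BP := in_cube_bclip Bb (cvalP b).
exists (tocbox K (bclip (ratr K%:num) B)).
  apply: (@rat_tocbox _ _ _ _ (\col_i Num.max (l i) (- K%:num))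
    (\col_i Num.min (h i) K%:num)); congr pair.
    by apply/matrixP => i j; rewrite !mxE ratr_max rmorphN.
  by apply/matrixP => i j; rewrite !mxE ratr_min.
rewrite !cbox_leP cval_tocbox// !cval_cfat; try exact: ltW.
split; apply: ble_bclip => i j; rewrite !mxE !ord1.
  have /andP[? ?] := lP i; have /andP[? ?] := hP i; split; lra.
have /andP[? ?] := lP i; have /andP[? ?] := hP i; split; lra.
Qed.

(** Around [x], continuity keeps [f] above [cfat (e / 2) (f x)], hence above a rational box [c]
    close to [f x]. The step function with value [cfat e c] on that cell belongs to [lower_star f],
    so every upper bound [g] is above it at [x]; then [e] tends to 0. *)
Lemma is_Dsup_lower_star f : DQ f -> is_Dsup (lower_star f) f.
Proof.
move=> fc; split=> // [b /lower_starP[_ [g [_ gf] bg]]|g _ gub].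
  by apply: fle_trans gf => x; exact: way_below_le.
move=> x; have H (e : rat) : 0 < e ->
    exists2 c, (cfat e (f x) <= c)%O & (cfat e c <= g x)%O.
  move=> e0; have e20 : 0 < e / 2 by rewrite divr_gt0.
  have [c cr [ec ce]] := rat_approx (f x) e0; exists c => //.
  have [pq pqx pqf] := (DQP f).1 fc x _ e20.
  have : fle (chi (cfat e c, pq)) g.
    apply: gub; apply/lower_starP; split; first exact/simple_chi/rat_cfat.
    exists (chi (c, pq)) => [|y].
      split=> [|y]; first exact: simple_chi.
      rewrite /chi; case: ifP => [/pqf|_]; last exact: cbot_le.
      by apply: le_trans.
    rewrite /chi /=; case: ifP => _; first exact: cfat_way_below.
    by apply: way_below_bot => z; exact: cbot_le.
  by move/(_ x); rewrite /chi /= ifT.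
apply/cbox_leP => i j; split; apply: le_of_ratr_eps => e e0.
all: have e20 : 0 < e / 2 by rewrite divr_gt0.
all: have e2E : ratr e = ratr (e / 2) + ratr (e / 2) :> R
  by rewrite -rmorphD /=; congr ratr; lra.
all: have [c /cfatP-/(_ (ltW e20) i j)[? ?]] := H _ e20.
all: move=> /cfatP-/(_ (ltW e20) i j)[? ?].
all: lra.
Qed.

Lemma upper_starK f : DQ f -> upper_star (lower_star f) = f.
Proof.
move=> /is_Dsup_lower_star fsup.
have [gc gub glub] : is_Dsup (lower_star f) (upper_star (lower_star f)).
  by apply: (@xgetPex _ _ (is_Dsup (lower_star f))); exists f.
have [fc fub flub] := fsup.
by apply: fle_anti; [exact: glub|exact: flub].
Qed.

(** The constant bottom map is the only member of the right-hand side. It is [triB]-below every step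
    function, so each rounded ideal, being non-empty and lower, contains it. *)
Lemma WbotE : Wbot n K a = lower_star (fun=> cbot K n 1) :> set (T -> IK).
Proof.
apply/seteqP; split=> [b|b]; first by apply; exact: WD_lower_star.
move=> /lower_starP[sb [g [_ gbot] bg]] phi [phiB [z phiz] phil _].
have -> : b = fun=> cbot K n 1.
  apply: fle_anti => x; last exact: cbot_le.
  by apply: le_trans (gbot x); exact: way_below_le.
apply: (phil _ z _ phiz); apply/triBP; split.
- exact/BDP/simple_cbot.
- exact: phiB.
- by move=> x; apply: way_below_bot => y; exact: cbot_le.
Qed.

End Ideals.

Lemma Rintegral_affine (R : realType) (q x c d : R) : q < x ->
  (\int[lebesgue_measure]_(t in `[q, x]) (c + (t - q) * d))%R =
  (x - q) * c + (x - q) ^+ 2 / 2 * d.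
Proof.
move=> qx; rewrite /Rintegral.
(* The antiderivative of the integrand that vanishes at [q]. *)
pose G (t : R) := (t - q) * c + (t - q) ^+ 2 / 2 * d.
have dG (t : R) : is_derive t 1 G (c + (t - q) * d).
  apply: is_derive_eq; rewrite /GRing.scale/=. 
  lra.
have cG : continuous G.
  move=> t; apply: differentiable_continuous; apply/derivable1_diffP.
  by have [] := dG t.
rewrite (@continuous_FTC2 _ _ G)//.
- by rewrite /= /G; ring.
- apply: continuous_subspaceT => t.
  apply: cvgD; first exact: cvg_cst.
  apply: cvgM; last exact: cvg_cst.
  by apply: cvgB; [exact: cvg_id|exact: cvg_cst].
- split=> [t _||]; first by have [] := dG t.
    by apply: cvg_at_right_filter; exact: cG.
  by apply: cvg_at_left_filter; exact: cG.
- by move=> t _; rewrite derive1E; have [_ ->] := dG t.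
Qed.

(** * Estimates for interval products and quadratic paths *)

Section IntervalProduct.
Context {R : realType}.
Implicit Types a b c d x y : R.

(** First [x] is moved to an endpoint chosen by the sign of [y], then [y] to an endpoint chosen by
    the sign of the endpoint reached. *)
Lemma imul_lo_le a b c d x y : a <= x <= b -> c <= y <= d ->
  imul_lo a b c d <= x * y.
Proof.
move=> /andP[ax xb] /andP[cy yd]; rewrite /imul_lo !ge_min.
have [y0|y0] := leP 0 y.
  have ay : a * y <= x * y by rewrite ler_wpM2r.
  have [a0|a0] := leP 0 a.
    have -> : a * c <= x * y by apply: le_trans ay; rewrite ler_wpM2l.
    by [].
  have -> : a * d <= x * y by apply: le_trans ay; rewrite ler_wnM2l // ltW.
  by rewrite orbT.
have by_ : b * y <= x * y by rewrite ler_wnM2r // ltW.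
have [b0|b0] := leP 0 b.
  have -> : b * c <= x * y by apply: le_trans by_; rewrite ler_wpM2l.
  by rewrite !orbT.
have -> : b * d <= x * y by apply: le_trans by_; rewrite ler_wnM2l // ltW.
by rewrite !orbT.
Qed.

(** Reflecting the first interval exchanges the two bounds, so upper estimates follow from lower
    ones. *)
Lemma imul_hiE a b c d : imul_hi a b c d = - imul_lo (- b) (- a) c d.
Proof.
rewrite /imul_hi /imul_lo !oppr_min !mulNr !opprK.
by rewrite maxC.
Qed.

Lemma imul_hi_ge a b c d x y : a <= x <= b -> c <= y <= d ->
  x * y <= imul_hi a b c d.
Proof.
move=> /andP[ax xb] cyd; rewrite imul_hiE lerNr -mulNr.
by apply: imul_lo_le => //; rewrite !lerN2 xb.
Qed.

Lemma imul_lo_ge a b c d z :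
  [/\ z <= a * c, z <= a * d, z <= b * c & z <= b * d] ->
  z <= imul_lo a b c d.
Proof. by rewrite /imul_lo !le_min => -[-> -> -> ->]. Qed.

Lemma imul_hi_le a b c d z :
  [/\ a * c <= z, a * d <= z, b * c <= z & b * d <= z] ->
  imul_hi a b c d <= z.
Proof. by rewrite /imul_hi !ge_max => -[-> -> -> ->]. Qed.

Lemma imul_sub a b c d a' b' c' d' :
  a <= a' -> a' <= b' -> b' <= b -> c <= c' -> c' <= d' -> d' <= d ->
  imul_lo a b c d <= imul_lo a' b' c' d' /\
  imul_hi a' b' c' d' <= imul_hi a b c d.
Proof.
move=> ? ? ? ? ? ?; split; [apply: imul_lo_ge|apply: imul_hi_le].
all: by split; (apply: imul_lo_le || apply: imul_hi_ge); apply/andP; split; lra.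
Qed.

Lemma imul_bound a b c d A C : - A <= a -> a <= b -> b <= A ->
  - C <= c -> c <= d -> d <= C ->
  [/\ - (A * C) <= imul_lo a b c d, imul_lo a b c d <= imul_hi a b c d &
    imul_hi a b c d <= A * C].
Proof.
move=> ? ? ? ? ? ?; split.
- by apply: imul_lo_ge; split; nra.
- by apply: (@le_trans _ _ (a * c)); [apply: imul_lo_le|apply: imul_hi_ge];
    apply/andP; split; lra.
- by apply: imul_hi_le; split; nra.
Qed.

(* Lipschitz estimate for the solution of y'(s) = U + s W over s in [0, 1] *)
Lemma quadratic_lipschitz (A C U W s t : R) :
  - A <= U <= A -> - C <= W <= C -> 0 <= s <= 1 -> 0 <= t <= 1 ->
  `|(s * U + s ^+ 2 / 2 * W) - (t * U + t ^+ 2 / 2 * W)| <= `|s - t| * (A + C).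
Proof.
move=> /andP[? ?] /andP[? ?] /andP[? ?] /andP[? ?].
have -> : (s * U + s ^+ 2 / 2 * W) - (t * U + t ^+ 2 / 2 * W) =
  (s - t) * (U + (s + t) / 2 * W) by field.
rewrite normrM ler_wpM2l // ler_norml; apply/andP; split; nra.
Qed.

End IntervalProduct.

(** * Speed, continuity and monotonicity of the second-order Taylor step *)

Section TaylorStep.
Context {R : realType} {n : nat} {K M M1 : {posnum rat}}.
Local Notation IK := (cbox R K n 1).
Context (u : IK -> cbox R M n 1) (u' : IK -> cbox R M1 n n).
Implicit Types (al be : IK) (q x y : R).

(** A Lipschitz constant in time for steps of length at most 1: the first-order term contributes
    [M], and the second-order term at most [n * M1 * M]. *)
Definition speed : rat := M%:num * (1 + n%:R * M1%:num).

Lemma speed_gt0 : 0 < speed.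
Proof. by rewrite mulr_gt0. Qed.

Lemma speedE :
  ratr speed = ratr M%:num + n%:R * (ratr M1%:num * ratr M%:num) :> R.
Proof. by rewrite !(rmorphM, rmorphD) /= rmorph1 ratr_nat; ring. Qed.

Lemma speed_ge0R : 0 <= ratr speed :> R.
Proof. by rewrite ler0q ltW // speed_gt0. Qed.

(** Formally an enclosure of the second derivative, since y' = h(y) gives y'' = h'(y) h(y). *)
Definition curv be : box R n 1 := bmulmx (u' be) (u be).

Lemma curv_bounds be i j :
  let B : R := n%:R * (ratr M1%:num * ratr M%:num) in
  [/\ - B <= (curv be).1 i j, (curv be).1 i j <= (curv be).2 i j &
    (curv be).2 i j <= B].
Proof.
have nE (c : R) : n%:R * c = \sum_(k < n) c.
  by rewrite sumr_const card_ord mulr_natl.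
have H k : [/\ - (ratr M1%:num * ratr M%:num) <=
    imul_lo ((cval (u' be)).1 i k) ((cval (u' be)).2 i k)
      ((cval (u be)).1 k j) ((cval (u be)).2 k j),
    imul_lo ((cval (u' be)).1 i k) ((cval (u' be)).2 i k)
      ((cval (u be)).1 k j) ((cval (u be)).2 k j) <=
    imul_hi ((cval (u' be)).1 i k) ((cval (u' be)).2 i k)
      ((cval (u be)).1 k j) ((cval (u be)).2 k j) &
    imul_hi ((cval (u' be)).1 i k) ((cval (u' be)).2 i k)
      ((cval (u be)).1 k j) ((cval (u be)).2 k j) <=
    ratr M1%:num * ratr M%:num].
  have [? ? ?] := cboxP (u' be) i k; have [? ? ?] := cboxP (u be) k j.
  exact: imul_bound.
rewrite /= !mxE -mulrN !nE; split; apply: ler_sum => k _.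
all: by have [] := H k.
Qed.

(** For [t >= q] scaling by [t - q] keeps the order of the endpoints, so each bound is the integral
    of one affine function. *)
Lemma taylor_stepE al be q x : q < x -> forall i j,
  (taylor_step u u' al be q x).1 i j = (cval al).1 i j +
    ((x - q) * (cval (u al)).1 i j + (x - q) ^+ 2 / 2 * (curv be).1 i j) /\
  (taylor_step u u' al be q x).2 i j = (cval al).2 i j +
    ((x - q) * (cval (u al)).2 i j + (x - q) ^+ 2 / 2 * (curv be).2 i j).
Proof.
move=> qx; rewrite /taylor_step -/(curv be).
have W12 i j : (curv be).1 i j <= (curv be).2 i j.
  by have [] := curv_bounds be i j.
move: (curv be) W12 => W W12 i j; rewrite /badd /bintegral /=.
split; rewrite [LHS]mxE; congr +%R;
  rewrite -Rintegral_affine// [LHS]mxE; apply: eq_Rintegral => t;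
  rewrite inE /= in_itv/= => /andP[qt _]; rewrite mxE; congr +%R; rewrite mxE.
  by rewrite min_l // ler_wpM2l // subr_ge0.
by rewrite max_r // ler_wpM2l // subr_ge0.
Qed.

(** The window of length 1 is what a mesh of at most 1 provides; on it the weight [s ^+ 2 / 2] has
    slope at most 1. *)
Lemma taylor_step_lipschitz al be q x y : q < x <= q + 1 -> q < y <= q + 1 ->
  forall i j, (taylor_step u u' al be q x).1 i j - `|x - y| * ratr speed <=
    (taylor_step u u' al be q y).1 i j /\
  (taylor_step u u' al be q y).2 i j <=
    (taylor_step u u' al be q x).2 i j + `|x - y| * ratr speed.
Proof.
move=> /andP[qx xq] /andP[qy yq] i j; rewrite speedE.
move: (taylor_stepE al be qx i j) (taylor_stepE al be qy i j).
move: (taylor_step _ _ _ _ _ x) (taylor_step _ _ _ _ _ y) => tx ty.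
move=> [-> ->] [-> ->].
have [u1 u2 u3] := cboxP (u al) i j; have [c1 c2 c3] := curv_bounds be i j.
have xyE : x - y = (x - q) - (y - q) by lra.
split.
  have := @quadratic_lipschitz R (ratr M%:num)
    (n%:R * (ratr M1%:num * ratr M%:num)) ((cval (u al)).1 i j)
    ((curv be).1 i j) (x - q) (y - q).
  rewrite -xyE u1 c1 (le_trans u2 u3) (le_trans c2 c3) => /(_ isT isT).
  by rewrite !subr_ge0 !lerBlDl !(ltW qx, ltW qy) xq yq => /(_ isT isT);
    rewrite ler_norml => /andP[? ?]; lra.
have := @quadratic_lipschitz R (ratr M%:num)
  (n%:R * (ratr M1%:num * ratr M%:num)) ((cval (u al)).2 i j)
  ((curv be).2 i j) (x - q) (y - q).
rewrite -xyE u3 c3 (le_trans u1 u2) (le_trans c1 c2) => /(_ isT isT).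
by rewrite !subr_ge0 !lerBlDl !(ltW qx, ltW qy) xq yq => /(_ isT isT);
  rewrite ler_norml => /andP[? ?]; lra.
Qed.

(** The Lipschitz estimate is applied against elapsed time 0, where the increment vanishes. *)
Lemma taylor_step_bounds al be q x : q < x <= q + 1 -> forall i j,
  [/\ (cval al).1 i j - (x - q) * ratr speed <=
      (taylor_step u u' al be q x).1 i j,
    (taylor_step u u' al be q x).1 i j <= (taylor_step u u' al be q x).2 i j &
    (taylor_step u u' al be q x).2 i j <=
      (cval al).2 i j + (x - q) * ratr speed].
Proof.
move=> /andP[qx xq] i j; rewrite speedE.
move: (taylor_stepE al be qx i j).
move: (taylor_step _ _ _ _ _ x) => tx [-> ->].
have [u1 u2 u3] := cboxP (u al) i j; have [c1 c2 c3] := curv_bounds be i j.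
have [_ a2 _] := cboxP al i j.
set B := n%:R * _ in c1 c3 *; set A := ratr M%:num in u1 u3 *.
have s1 : 0 <= x - q <= 1 by apply/andP; lra.
have s01 : 0 <= (0 : R) <= 1 by rewrite lexx ler01.
have lip U W : - A <= U <= A -> - B <= W <= B ->
    `|(x - q) * U + (x - q) ^+ 2 / 2 * W| <= (x - q) * (A + B).
  move=> UA WB; have := quadratic_lipschitz UA WB s1 s01.
  by rewrite expr0n /= !mul0r addr0 !subr0 [`|x - q|]ger0_norm // subr_ge0 ltW.
have := lip ((cval (u al)).1 i j) ((curv be).1 i j).
rewrite u1 c1 (le_trans u2 u3) (le_trans c2 c3) => /(_ isT isT).
rewrite ler_norml => /andP[? _].
have := lip ((cval (u al)).2 i j) ((curv be).2 i j).
rewrite u3 c3 (le_trans u1 u2) (le_trans c1 c2) => /(_ isT isT).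
rewrite ler_norml => /andP[_ ?].
split; [lra| |lra].
rewrite lerD // lerD // ler_wpM2l ?subr_ge0 ?(ltW qx) //.
by rewrite divr_ge0 // sqr_ge0.
Qed.

Context (u_homo : forall b c, (b <= c)%O -> (u b <= u c)%O)
  (u'_homo : forall b c, (b <= c)%O -> (u' b <= u' c)%O).

Lemma curv_homo be be' : (be <= be')%O -> ble (curv be) (curv be').
Proof.
move=> bebe i j.
have H k : imul_lo ((cval (u' be)).1 i k) ((cval (u' be)).2 i k)
      ((cval (u be)).1 k j) ((cval (u be)).2 k j) <=
    imul_lo ((cval (u' be')).1 i k) ((cval (u' be')).2 i k)
      ((cval (u be')).1 k j) ((cval (u be')).2 k j) /\
    imul_hi ((cval (u' be')).1 i k) ((cval (u' be')).2 i k)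
      ((cval (u be')).1 k j) ((cval (u be')).2 k j) <=
    imul_hi ((cval (u' be)).1 i k) ((cval (u' be)).2 i k)
      ((cval (u be)).1 k j) ((cval (u be)).2 k j).
  have /cbox_leP/(_ i k)[? ?] := u'_homo bebe.
  have /cbox_leP/(_ k j)[? ?] := u_homo bebe.
  have [_ ? _] := cboxP (u' be') i k; have [_ ? _] := cboxP (u be') k j.
  exact: imul_sub.
by rewrite !mxE; split; apply: ler_sum => k _; have [] := H k.
Qed.

(** In the closed form of [taylor_stepE] the coefficients of the bounds of [u] and [curv] are
    non-negative. *)
Lemma taylor_step_homo al be al' be' q x : (al <= al')%O -> (be <= be')%O ->
  q < x -> ble (taylor_step u u' al be q x) (taylor_step u u' al' be' q x).
Proof.
move=> alal bebe qx i j.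
move: (taylor_stepE al be qx i j) (taylor_stepE al' be' qx i j).
move: (taylor_step _ _ al _ _ _) (taylor_step _ _ al' _ _ _) => t t'.
move=> [-> ->] [-> ->].
have /cbox_leP/(_ i j)[? ?] := alal.
have /cbox_leP/(_ i j)[? ?] := u_homo alal.
have [cl ch] := curv_homo bebe i j.
have s0 : 0 <= x - q by rewrite subr_ge0 ltW.
have s20 : 0 <= (x - q) ^+ 2 / 2 by rewrite divr_ge0 // sqr_ge0.
by split; rewrite lerD // lerD // ler_wpM2l.
Qed.

End TaylorStep.

Arguments speed n M M1 : clear implicits.

(** * Nodes and pieces of a partition *)

Section PartitionNodes.
Context {R : realType} {a : rat} {Q : seq rat} (hQ : partition1 a Q).
Local Notation q i := (ratr Q`_i : R).

Lemma node_lt i j : (i < j)%N -> (j < size Q)%N -> Q`_i < Q`_j.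
Proof.
move=> ij js; have [[_ _ _ sQ] _] := hQ.
by rewrite lt_sorted_ltn_nth // inE // (ltn_trans ij).
Qed.

Lemma node_le i j : (i <= j)%N -> (j < size Q)%N -> Q`_i <= Q`_j.
Proof.
by rewrite leq_eqVlt => /orP[/eqP -> //|ij js]; exact/ltW/node_lt.
Qed.

Lemma node_bounds i : (i < size Q)%N -> 0 <= Q`_i <= a.
Proof.
move=> iQ; have [[Q1 Q0 Qa _] _] := hQ; apply/andP; split.
  by rewrite -[X in X <= _]Q0 node_le.
have -> : a = Q`_(size Q).-1 by rewrite nth_last.
have Qpos : (0 < size Q)%N by apply: leq_ltn_trans iQ.
by apply: node_le; [rewrite -ltnS prednK|rewrite prednK].
Qed.

Lemma step_size_bounds i : (i.+1 < size Q)%N -> 0 < step_size Q i <= 1.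
Proof.
move=> iQ; have [_ mQ] := hQ; rewrite subr_gt0 node_lt //=.
apply: le_trans mQ; have iQ' : (i < (size Q).-1)%N.
  by rewrite -ltnS prednK // (leq_ltn_trans _ iQ).
exact: (le_bigmax 0 (fun i : 'I_(size Q).-1 => step_size Q i) (Ordinal iQ')).
Qed.

Lemma step_lt i : (i.+1 < size Q)%N -> q i < q i.+1.
Proof. by move=> iQ; rewrite ltr_rat node_lt. Qed.

Lemma step_interval i x : (i.+1 < size Q)%N -> q i < x <= q i.+1 ->
  q i < x <= q i + 1.
Proof.
move=> iQ /andP[-> xq] /=; apply: le_trans xq _.
have /andP[_] := step_size_bounds iQ; rewrite lerBlDl -(ler_rat R).
by rewrite rmorphD /= rmorph1 addrC.
Qed.

Lemma pieceE i (x : R) : (i.+1 < size Q)%N -> q i < x <= q i.+1 ->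
  piece Q x = i.
Proof.
move=> iQ /andP[qx xq]; rewrite /piece.
(* The search stops at the right end of the piece, which is included in it; [piece] then steps back
   by one. *)
suff -> : find (fun p => x <= ratr p) Q = i.+1 by [].
have hQx : has (fun p => x <= ratr p) Q.
  by apply/hasP; exists Q`_i.+1 => //; exact: mem_nth.
apply/eqP; rewrite eqn_leq; apply/andP; split.
  rewrite leqNgt; apply/negP => /(before_find 0).
  by rewrite xq.
rewrite ltnNge; apply/negP => fi; have := nth_find 0 hQx.
rewrite leNgt => /negP; apply; apply: le_lt_trans qx.
by rewrite ler_rat node_le // (ltn_trans _ iQ).
Qed.

Lemma piece_exists (x : R) : 0 < x <= ratr a ->
  exists2 i, (i.+1 < size Q)%N & q i < x <= q i.+1.
Proof.
move=> /andP[x0 xa]; have [[Q1 Q0 Qa _] _] := hQ.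
have hQx : has (fun p => x <= ratr p) Q.
  apply/hasP; exists Q`_(size Q).-1; last by rewrite nth_last Qa.
  by apply: mem_nth; rewrite prednK // (ltn_trans _ Q1).
have := nth_find 0 hQx; move: hQx; rewrite has_find.
case fE : (find _ Q) => [|i] iQ xi.
  (* The search cannot stop at index 0, because [x] exceeds the first node 0. *)
  by move: xi; rewrite Q0 rmorph0 leNgt x0.
exists i => //; rewrite xi andbT ltNge.
by have := @before_find _ 0 (fun p => x <= ratr p) Q i; rewrite fE => ->.
Qed.

End PartitionNodes.

(** * The iterates of [Phi] and their agreement with [E2] *)

Section Iteration.
Context {R : realType} {n : nat} {K M M1 a : {posnum rat}} {Q : seq rat}.
Context (ha : a%:num * speed n M M1 <= K%:num) (hQ : partition1 a%:num Q).
Local Notation T := (time R a).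
Local Notation IK := (cbox R K n 1).
Context (u : IK -> cbox R M n 1) (u' : IK -> cbox R M1 n n).
Context (u_homo : forall b c, (b <= c)%O -> (u b <= u c)%O)
  (u'_homo : forall b c, (b <= c)%O -> (u' b <= u' c)%O).
Local Notation q i := (ratr Q`_i : R).
Local Notation C := (ratr (speed n M M1) : R).
Local Notation node := (E2_node u u' Q).
Local Notation Y := (E2 u u' Q : T -> IK).
Implicit Types (f g : T -> IK) (al : IK).

Let C0 : 0 <= C. Proof. exact: speed_ge0R. Qed.

Let aC : ratr a%:num * C <= ratr K%:num.
Proof. by rewrite -rmorphM ler_rat. Qed.

Lemma tval_ratpt i : (i < size Q)%N -> tval (ratpt R a Q`_i) = q i.
Proof.
move=> iQ; rewrite /ratpt insubdK //; have /andP[? ?] := node_bounds hQ iQ.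
by apply/andP; rewrite ler0q ler_rat.
Qed.

Lemma zeroboxE : cval (zerobox : IK) = (0, 0).
Proof.
rewrite cval_tocbox //; apply/in_cube_bounds => i j; rewrite !mxE.
by rewrite oppr_le0 ler0q.
Qed.

(** The invariant is that at time [x] all bounds of the Euler solution lie within [x * C]; it
    propagates because [C] bounds the speed. As [a * C <= K], no box leaves the cube. *)
Lemma node_step i : (i < size Q)%N ->
  (forall k l, - (q i * C) <= (cval (node i)).1 k l /\
    (cval (node i)).2 k l <= q i * C) /\
  ((i.+1 < size Q)%N -> in_cube (ratr K%:num) (fat M Q i (node i)) /\
    forall x, q i < x <= q i.+1 ->
      in_cube (ratr K%:num) (E2_step u u' Q i (node i) x)).
Proof.
have qK j : (j < size Q)%N -> q j * C <= ratr K%:num.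
  move=> jQ; apply: le_trans aC; rewrite ler_wpM2r // ler_rat.
  by have /andP[] := node_bounds hQ jQ.
have step j : (j.+1 < size Q)%N ->
  (forall k l, - (q j * C) <= (cval (node j)).1 k l /\
    (cval (node j)).2 k l <= q j * C) ->
  forall x, q j < x <= q j.+1 -> forall k l,
    [/\ - (x * C) <= (E2_step u u' Q j (node j) x).1 k l,
     (E2_step u u' Q j (node j) x).1 k l <=
       (E2_step u u' Q j (node j) x).2 k l &
     (E2_step u u' Q j (node j) x).2 k l <= x * C].
  move=> jQ jB x xj k l; have xj1 := step_interval hQ jQ xj.
  have [? ?] := jB k l.
  have [] := taylor_step_bounds u u' (node j)
    (tocbox K (fat M Q j (node j))) xj1 k l.
  rewrite -/(E2_step u u' Q j (node j) x).
  move: (E2_step _ _ _ _ _ _) => t; rewrite mulrBl; split; lra.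
have stepK j : (j.+1 < size Q)%N ->
  (forall k l, - (q j * C) <= (cval (node j)).1 k l /\
    (cval (node j)).2 k l <= q j * C) ->
  forall x, q j < x <= q j.+1 ->
    in_cube (ratr K%:num) (E2_step u u' Q j (node j) x).
  move=> jQ jB x xj; apply/in_cube_bounds => k l.
  have xK : x * C <= ratr K%:num.
    apply: le_trans (qK _ jQ); rewrite ler_wpM2r //.
    by have /andP[] := xj.
  move: (step j jQ jB x xj k l); move: (E2_step _ _ _ _ _ _) => t [h1 h2 h3].
  by split; [lra|exact: h2|lra].
suff H j : (j < size Q)%N -> forall k l,
    - (q j * C) <= (cval (node j)).1 k l /\ (cval (node j)).2 k l <= q j * C.
  move=> iQ; split; [exact: H|move=> iQ1; split; last exact: stepK (H _ iQ)].
  apply/in_cube_bounds => k l; have [? ?] := H i iQ k l.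
  have [_ ? _] := cboxP (node i) k l.
  (* Since [M] is at most the speed, fattening by [M] times the step size stays within the bound
     reached at the next node. *)
  have qi1 : q i * C + ratr (M%:num * step_size Q i) <= ratr K%:num.
    apply: le_trans (qK _ iQ1); rewrite -!rmorphM -rmorphD ler_rat.
    rewrite -lerBrDl -mulrBl mulrC ler_wpM2l //.
      by have /andP[/ltW] := step_size_bounds hQ iQ1.
    by rewrite /speed ler_peMr // lerDl mulr_ge0.
  have d0 : 0 <= ratr (M%:num * step_size Q i) :> R.
    rewrite ler0q mulr_ge0 //.
    by have /andP[/ltW] := step_size_bounds hQ iQ1.
  by rewrite !mxE; split; lra.
elim: j => [_ k l|j IHj jQ].
  have [[_ Q0 _ _] _] := hQ.
  by rewrite /= zeroboxE Q0 !mxE rmorph0 mul0r oppr0.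
have jQ' := ltn_trans (ltnSn j) jQ.
have qj : q j < q j.+1 <= q j.+1 by rewrite lexx andbT (step_lt hQ).
move=> k l; rewrite [node _]/= cval_tocbox; last exact: stepK (IHj jQ') _ qj.
by have [h1 _ h2] := step j jQ (IHj jQ') _ qj k l; exact: conj h1 h2.
Qed.

Lemma E2_definedT : E2_defined u u' Q.
Proof.
by move=> i iQ; have [_ H] := node_step (ltn_trans (ltnSn i) iQ); exact: H.
Qed.

Lemma E2_piece i (x : T) : (i.+1 < size Q)%N -> q i < tval x <= q i.+1 ->
  Y x = tocbox K (E2_step u u' Q i (node i) (tval x)).
Proof.
move=> iQ xi; rewrite /E2 (pieceE hQ iQ xi) ifF //; apply/negbTE.
have /andP[qx _] := xi; rewrite gt_eqF //; apply: le_lt_trans qx.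
by rewrite ler0q; have /andP[] := node_bounds hQ (ltn_trans (ltnSn i) iQ).
Qed.

Lemma Phi_piece f i (x : T) : (i.+1 < size Q)%N -> q i < tval x <= q i.+1 ->
  Phi u u' Q f x = tocbox K (Phi_step u u' Q i (f (ratpt R a Q`_i)) (tval x)).
Proof.
move=> iQ xi; rewrite /Phi (pieceE hQ iQ xi) ifF //; apply/negbTE.
have /andP[qx _] := xi; rewrite gt_eqF //; apply: le_lt_trans qx.
by rewrite ler0q; have /andP[] := node_bounds hQ (ltn_trans (ltnSn i) iQ).
Qed.

Lemma time_cases (x : T) : tval x = 0 \/
  exists2 i, (i.+1 < size Q)%N & q i < tval x <= q i.+1.
Proof.
have /andP[] := tvalP x; rewrite le_eqVlt.
move=> /orP[/eqP <- _|x0 xa]; first by left.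
by right; apply: (piece_exists hQ); rewrite x0.
Qed.

Lemma E2_ratpt i : (i < size Q)%N -> Y (ratpt R a Q`_i) = node i.
Proof.
case: i => [|i] iQ.
  have [[_ Q0 _ _] _] := hQ.
  by rewrite /E2 tval_ratpt // Q0 rmorph0 eqxx.
have ti := tval_ratpt iQ.
have xi : q i < tval (ratpt R a Q`_i.+1) <= q i.+1.
  by rewrite ti lexx andbT (step_lt hQ).
by rewrite (E2_piece iQ xi) ti.
Qed.

Lemma clip_fat_node i : (i.+1 < size Q)%N ->
  clip_fat M Q i (node i) = fat M Q i (node i).
Proof. by move=> iQ; have [fatK _] := E2_definedT iQ; exact: bclip_id. Qed.

Lemma Phi_step_node i x : (i.+1 < size Q)%N -> q i < x <= q i.+1 ->
  Phi_step u u' Q i (node i) x = E2_step u u' Q i (node i) x.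
Proof.
move=> iQ xi; have [_ stepK] := E2_definedT iQ.
rewrite /Phi_step clip_fat_node // -/(E2_step u u' Q i (node i) x).
exact: bclip_id (stepK x xi).
Qed.

Lemma Phi_eq_E2 f i (x : T) : (i.+1 < size Q)%N -> q i < tval x <= q i.+1 ->
  f (ratpt R a Q`_i) = node i -> Phi u u' Q f x = Y x.
Proof.
by move=> iQ xi fi; rewrite (Phi_piece f iQ xi) fi Phi_step_node // -E2_piece.
Qed.

Lemma in_cube_clip_fat i al : (i.+1 < size Q)%N ->
  in_cube (ratr K%:num) (clip_fat M Q i al).
Proof.
move=> iQ; apply: in_cube_bclip (cvalP al); apply: ble_bfatten.
by rewrite mulr_ge0 //; have /andP[/ltW] := step_size_bounds hQ iQ.
Qed.

(** By inclusion monotonicity the unclipped step from [al] contains the Euler step, which lies in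
    the cube; so the clipped step is non-empty and still contains it. *)
Lemma Phi_step_le i al x : (i.+1 < size Q)%N -> q i < x <= q i.+1 ->
  (al <= node i)%O ->
  in_cube (ratr K%:num) (Phi_step u u' Q i al x) /\
  ble (Phi_step u u' Q i al x) (E2_step u u' Q i (node i) x).
Proof.
move=> iQ xi alN; have [_ stepK] := E2_definedT iQ.
have be : (tocbox K (clip_fat M Q i al) <=
    tocbox K (clip_fat M Q i (node i)))%O.
  apply/cbox_leP; rewrite !cval_tocbox; try exact: in_cube_clip_fat.
  apply: ble_bclip => k l; have /cbox_leP/(_ k l)[? ?] := alN.
  by rewrite !mxE; lra.
have /andP[qx _] := xi.
have := taylor_step_homo u_homo u'_homo alN be qx.
rewrite (clip_fat_node iQ) -/(E2_step u u' Q i (node i) x) => H; split.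
  exact: in_cube_bclip H (stepK x xi).
rewrite -[X in ble _ X](bclip_id (stepK x xi)); exact: ble_bclip H.
Qed.

Lemma fle_node f i : fle f Y -> (i < size Q)%N ->
  (f (ratpt R a Q`_i) <= node i)%O.
Proof. by move=> fY iQ; rewrite -E2_ratpt. Qed.

Lemma Phi_definedT f : fle f Y -> Phi_defined u u' Q f.
Proof.
move=> fY i iQ; have iQ' := ltn_trans (ltnSn i) iQ; split.
  by have /in_cubeP[] := in_cube_clip_fat (f (ratpt R a Q`_i)) iQ.
move=> x xi; have [+ _] := Phi_step_le iQ xi (fle_node fY iQ').
by case/in_cubeP.
Qed.

Lemma Phi_le f : fle f Y -> fle (Phi u u' Q f) Y.
Proof.
move=> fY x; have [x0|[i iQ xi]] := time_cases x.
  by rewrite /E2 /Phi x0 eqxx.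
have [PK PE] := Phi_step_le iQ xi (fle_node fY (ltn_trans (ltnSn i) iQ)).
rewrite (Phi_piece f iQ xi) (E2_piece iQ xi); apply/cbox_leP.
by rewrite !cval_tocbox //; have [_] := E2_definedT iQ; apply.
Qed.

(** Inside a piece the value is Lipschitz in time. Jumps just after a node do no harm, because a
    half-open cell ending at the node avoids them. *)
Lemma Phi_DQ f : fle f Y -> DQ (Phi u u' Q f).
Proof.
move=> fY; apply/DQP => x e e0; have [x0|[i iQ xi]] := time_cases x.
  (* The cell [(-1, 0]] meets the time interval in 0 only. *)
  exists (-1, 0).
    by rewrite /ocint /= x0 rmorphN rmorph0 rmorph1 lexx andbT oppr_lt0.
  move=> y; rewrite /ocint /= rmorph0 => /andP[_ y0].
  have yx : y = x.
    apply: val_inj => /=; rewrite x0; apply/le_anti; rewrite y0.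
    by have /andP[] := tvalP y.
  by rewrite yx; exact/cfat_le/ltW.
have C1 : 0 < speed n M M1 := speed_gt0.
pose d := e / speed n M M1.
have d0 : 0 < ratr d :> R by rewrite ltr0q divr_gt0.
have dC : ratr d * C = ratr e :> R by rewrite -rmorphM divfK // gt_eqF.
have [|p] := @rat_in_itvoo R (tval x - ratr d) (tval x); first lra.
rewrite in_itv /= => /andP[px xp].
have [|r] := @rat_in_itvoo R (tval x) (tval x + ratr d); first lra.
rewrite in_itv /= => /andP[rx xr].
have /andP[qx xq] := xi.
(* The cell is cut down to the piece of [x], and [p], [r] keep its points within [d] of [x], so that
   the value changes by at most [d * C = e]. *)
exists (Num.max Q`_i p, Num.min Q`_i.+1 r).
  by rewrite /ocint /= ratr_max ratr_min gt_max le_min qx xp xq (ltW rx).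
move=> y; rewrite /ocint /= ratr_max ratr_min gt_max le_min.
move=> /andP[/andP[qy py] /andP[yq yr]].
have yi : q i < tval y <= q i.+1 by rewrite qy.
have alN := fle_node fY (ltn_trans (ltnSn i) iQ).
rewrite (Phi_piece f iQ xi) (Phi_piece f iQ yi).
have [xK _] := Phi_step_le iQ xi alN; have [yK _] := Phi_step_le iQ yi alN.
apply: cfat_bclip xK yK _ => [|k l]; first exact: ltW.
have [] := taylor_step_lipschitz u u' (f (ratpt R a Q`_i))
  (tocbox K (clip_fat M Q i (f (ratpt R a Q`_i))))
  (step_interval hQ iQ xi) (step_interval hQ iQ yi) k l.
move: (taylor_step _ _ _ _ _ _) (taylor_step _ _ _ _ _ _) => tx ty.
have xye : `|tval x - tval y| * C <= ratr e.
  by rewrite -dC ler_wpM2r // ler_norml; apply/andP; split; lra.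
by move=> h1 h2; split; lra.
Qed.

Definition Phi_iter m : T -> IK := iter m (Phi u u' Q) (fun=> cbot K n 1).

Lemma Phi_iter_le m : fle (Phi_iter m) Y.
Proof. by elim: m => [x|m /Phi_le//]; exact: cbot_le. Qed.

Lemma Phi_iter_DQ m : DQ (Phi_iter m).
Proof.
case: m => [|m]; first exact/simple_DQ/simple_cbot.
exact/Phi_DQ/Phi_iter_le.
Qed.

(** The value of [Phi Q f] at a node depends only on [f] at the preceding node, so every application
    makes one more node exact, beginning with the node 0. *)
Lemma Phi_iter_node m i : (i < m)%N -> (i < size Q)%N ->
  Phi_iter m (ratpt R a Q`_i) = node i.
Proof.
elim: m i => // m IHm [|i] im iQ.
  rewrite /= /Phi tval_ratpt //.
  by have [[_ -> _ _] _] := hQ; rewrite rmorph0 eqxx.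
have iQ' := ltn_trans (ltnSn i) iQ.
rewrite -E2_ratpt //; apply: (Phi_eq_E2 iQ); last exact: IHm.
by rewrite tval_ratpt // lexx andbT (step_lt hQ).
Qed.

(** After k applications all left endpoints of pieces are exact; one more fills in every piece. *)
Lemma Phi_iter_E2 : Phi_iter (size Q) = Y.
Proof.
have [[Q1 _ _ _] _] := hQ; rewrite -(prednK (ltnW Q1)).
apply/funext => x /=; have [x0|[i iQ xi]] := time_cases x.
  by rewrite /E2 /Phi x0 eqxx.
apply: (Phi_eq_E2 iQ xi); apply: Phi_iter_node; last exact: ltn_trans iQ.
by rewrite -ltnS prednK // ltnW.
Qed.

(** Continuity of the iterates lets [upper_starK] cancel the two star maps between consecutive
    applications. *)
Lemma F_iterE m :
  iter m (F (a := a) u u' Q) (Wbot n K a) = lower_star (Phi_iter m).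
Proof.
elim: m => [|m IHm]; first exact: WbotE.
by rewrite iterS IHm /F upper_starK //; exact: Phi_iter_DQ.
Qed.

End Iteration.

Theorem theorem5p7 (R : realType) (n : nat) (hn : (0 < n)%N)
    (K M M1 a : {posnum rat})
    (ha : a%:num <= K%:num / (M%:num * (1 + n%:R * M1%:num)))
    (k : nat) (Q : seq rat) (hQ : partition1 a%:num Q) (hk : size Q = k.+1)
    (u : cbox R K n 1 -> cbox R M n 1) (u' : cbox R K n 1 -> cbox R M1 n n)
    (huu' : V1 u u') :
  [/\ E2_defined u u' Q,
      forall m, WD (iter m (F (a := a) u u' Q) (Wbot n K a)) /\
        F_defined u u' Q (iter m (F (a := a) u u' Q) (Wbot n K a)) &
      exists psi : set (time R a -> cbox R K n 1),
        [/\ is_Wsup (range (fun m => iter m (F u u' Q) (Wbot n K a))) psi,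
            psi = iter k.+1 (F u u' Q) (Wbot n K a) &
            E2 u u' Q = upper_star psi]].
Proof.
have [/scott_continuous_homo u_homo /scott_continuous_homo u'_homo _] := huu'.
have aK : a%:num * speed n M M1 <= K%:num by rewrite -ler_pdivlMr // speed_gt0.
have FE := F_iterE aK hQ u_homo u'_homo.
have fDQ := Phi_iter_DQ aK hQ u_homo u'_homo.
have fle_E2 := Phi_iter_le aK hQ u_homo u'_homo.
split; first exact: E2_definedT aK hQ u u'.
  move=> m; rewrite FE; split; first exact: WD_lower_star.
  by rewrite /F_defined upper_starK //; apply: Phi_definedT.
(* This ideal bounds all iterates because every [Phi] iterate is below [E2], and it is least because
   it is itself the iterate of index [k.+1]. *)
exists (lower_star (E2 u u' Q)).
have E2E := Phi_iter_E2 aK hQ u u'.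
have psiE : lower_star (E2 u u' Q) = iter k.+1 (F (a := a) u u' Q) (Wbot n K a).
  by rewrite FE -hk E2E.
split; [|exact: psiE|by rewrite upper_starK // -E2E].
split; first exact: WD_lower_star.
  by move=> _ [m _ <-]; rewrite FE; exact/lower_star_homo.
by move=> om _ omP; apply: omP; exists k.+1; [|exact: esym psiE].
Qed.
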